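(* Fix $p\in(0,1)$, $u,v>0$ with $u\neq v$, and $0\le \underline{s}<\overline{s}\le 1$ such that $\mathcal{E}_0\neq\emptyset$, and fix $\varepsilon_0>0$. Then there is a first-category subset $N$ of $F^\infty_{(\underline{s},\overline{s})}$ (with respect to the topology induced by the $L_\infty$-norm) such that for every $f\in F^\infty_{(\underline{s},\overline{s})}\setminus N$ the set $$S_f=\{c\in C_{\varepsilon_0} : \exists\,\lambda\in\mathcal{E}_0\cap\mathcal{E}_c \text{ with } G_f(\lambda,0)=G_f(\lambda,c)=0\}$$ has Lebesgue measure zero. (Equivalently: for almost all private signals, for almost every shock $c$, there is no $\lambda\in\mathcal{E}_0\cap\mathcal{E}_c$ at which action $b$ has the same probability under state $A$ and state $B$ both without shock and with shock $c$.)
   Context: Setting (observational learning with public payoff shock): two states $A,B$; players are of ''match'' type with probability $p$ and ''mismatch'' type otherwise; $u,v>0$ are payoff parameters and $c$ is a payoff shock. Private signals are direct signals taking values in $(\underline{s},\overline{s})$: a signal is identified with its density $f=f^A$ under state $A$, the density under state $B$ being $f^B(s)=f(s)\frac{1-s}{s}$. The signal space is $$F^\infty_{(\underline{s},\overline{s})}=\Big\{f\in L_\infty(\underline{s},\overline{s})\cap C^0(\underline{s},\overline{s}) : \int_{\underline{s}}^{\overline{s}} f(s)\tfrac{1-2s}{s}\,ds=0,\ \int_{\underline{s}}^{\overline{s}} f(s)\,ds=1,\ f\ge 0,\ f(s)\tfrac{1-s}{s}\in L_\infty(\underline{s},\overline{s})\Big\},$$ with the topology induced by the $L_\infty$-norm.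 For $\lambda>0$ and $c\in(-1,u)\cap(-v,1)$ (including $c=0$) define the cutoffs $$m(\lambda,c)=\frac{\lambda(1+c)}{\lambda(1+c)+(u-c)},\qquad mm(\lambda,c)=\frac{\lambda(1-c)}{\lambda(1-c)+(v+c)},$$ and $\mathcal{E}_c=\{\lambda\in(0,\infty): m(\lambda,c)\in(\underline{s},\overline{s}) \text{ and } mm(\lambda,c)\in(\underline{s},\overline{s})\}$. Let $C=\{c\in(-1,u)\cap(-v,1):\mathcal{E}_c\neq\emptyset\}\setminus\{0\}$ and $C_{\varepsilon_0}=C\cap(-1+\varepsilon_0,u-\varepsilon_0)\cap(-v+\varepsilon_0,1-\varepsilon_0)$. For $f\in F^\infty_{(\underline{s},\overline{s})}$ and $\lambda$ with $m(\lambda,c),mm(\lambda,c)\in(\underline{s},\overline{s})$ define $$G_f(\lambda,c)=p\int_{\underline{s}}^{m(\lambda,c)} f(s)\frac{1-2s}{s}\,ds+(1-p)\int_{mm(\lambda,c)}^{\overline{s}} f(s)\frac{1-2s}{s}\,ds,$$ which equals $\Pr(b\mid B,\lambda,c)-\Pr(b\mid A,\lambda,c)$, the difference of the probabilities of action $b$ under the two states when public likelihood ratio is $\lambda$ and the shock is $c$. *)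

(* Defs.v *)
From HB Require Import structures.
From mathcomp Require Import all_boot all_order all_algebra.
From mathcomp Require Import all_classical all_reals all_analysis.
Set Implicit Arguments. Unset Strict Implicit. Unset Printing Implicit Defensive.
Import Order.TTheory GRing.Theory Num.Theory.
Import numFieldNormedType.Exports.
Local Open Scope classical_set_scope.
Local Open Scope ring_scope.

Section Defs.
Variable R : realType.

Definition Iab (a b : R) : set R := `]a, b[%classic.

Definition mcut (u lam c : R) : R := lam * (1 + c) / (lam * (1 + c) + (u - c)).
Definition mmcut (v lam c : R) : R := lam * (1 - c) / (lam * (1 - c) + (v + c)).

Definition Eset (u v a b c : R) : set R :=
  [set lam | 0 < lam /\ Iab a b (mcut u lam c) /\ Iab a b (mmcut v lam c)].

Definition Cset (u v a b : R) : set R :=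
  [set c | (-1 < c < u) /\ (- v < c < 1) /\ Eset u v a b c !=set0 /\ c != 0].

Definition Ceps (u v a b eps0 : R) : set R :=
  [set c | Cset u v a b c /\ (-1 + eps0 < c < u - eps0) /\ (- v + eps0 < c < 1 - eps0)].

(* The signal space F^infty_{(a,b)}: continuous, essentially bounded
   (for continuous functions on an open interval: bounded), nonnegative,
   f(s)(1-s)/s bounded, and the two integral constraints. *)
Definition signal_space (a b : R) : set (R -> R) :=
  [set f : R -> R |
    {within Iab a b, continuous f} /\
    (exists M : R, forall s, Iab a b s -> `|f s| <= M) /\
    (forall s, Iab a b s -> 0 <= f s) /\
    (exists M : R, forall s, Iab a b s -> `|f s * (1 - s) / s| <= M) /\
    (\int[lebesgue_measure]_(s in Iab a b) (f s)%:E = 1%E)%E /\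
    (\int[lebesgue_measure]_(s in Iab a b) (f s * (1 - 2 * s) / s)%:E = 0%E)%E].

(* L_infty distance on (a,b); for continuous functions the essential sup
   equals the sup over the open interval *)
Definition supdist (a b : R) (f g : R -> R) : \bar R :=
  ereal_sup [set (`|f s - g s|)%:E | s in Iab a b].

Definition rel_closure (a b : R) (X A : set (R -> R)) : set (R -> R) :=
  [set g | X g /\ forall r : R, 0 < r ->
     exists h, X h /\ A h /\ (supdist a b g h < r%:E)%E].

Definition rel_interior (a b : R) (X B : set (R -> R)) : set (R -> R) :=
  [set g | X g /\ exists r : R, 0 < r /\
     forall h, X h -> (supdist a b g h < r%:E)%E -> B h].

Definition nowhere_dense_in (a b : R) (X A : set (R -> R)) : Prop :=
  rel_interior a b X (rel_closure a b X A) = set0.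

Definition first_category_in (a b : R) (X N : set (R -> R)) : Prop :=
  N `<=` X /\ exists A : nat -> set (R -> R),
    (forall n, nowhere_dense_in a b X (A n)) /\ N = \bigcup_n A n.

Definition Gf (p u v a b : R) (f : R -> R) (lam c : R) : R :=
  p * (\int[lebesgue_measure]_(s in Iab a (mcut u lam c)) (f s * (1 - 2 * s) / s))
  + (1 - p) * (\int[lebesgue_measure]_(s in Iab (mmcut v lam c) b) (f s * (1 - 2 * s) / s)).

Definition Sf (p u v a b eps0 : R) (f : R -> R) : set R :=
  [set c | Ceps u v a b eps0 c /\
     exists lam, Eset u v a b 0 lam /\ Eset u v a b c lam /\
       Gf p u v a b f lam 0 = 0 /\ Gf p u v a b f lam c = 0].

End Defs.

(* Main.v *)
Require Import Defs.
From HB Require Import structures.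
From mathcomp Require Import all_boot all_order all_algebra.
From mathcomp Require Import all_classical all_reals all_analysis.
From mathcomp Require Import measurable_realfun ring lra.
Import Order.TTheory GRing.Theory Num.Theory.
Import numFieldNormedType.Exports.
Local Open Scope classical_set_scope.
Local Open Scope ring_scope.

(** Since the integral of f(s)(1-2s)/s over (a,b) vanishes, G_f is a combination
    of the tails K_f(x) = int_x^b f(s)(1-2s)/s ds taken at the two cutoffs. Away
    from three exceptional shocks (and c = 0) the four cutoffs at (lambda,0) and
    (lambda,c) are distinct, so two perturbation directions of f move the pair
    (G_f(lambda,0), G_f(lambda,c)) by a matrix close to a multiple of the
    identity, uniformly on a small rectangle Q of pairs (lambda,c).

    Countably many such Q suffice, and for each Q and k the set of f for which
    the shocks in Q having a common zero cannot be covered in measure 1/(k+1)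
    is nowhere dense. To see this cut Q into N x N cells and try the N x N
    perturbations (i/N, j/N) of a given f. By Lipschitz continuity a cell can
    contain a common zero only if both values at its corner are O(1/N), and by
    the near-identity property this happens for O(1) perturbations per cell.
    Hence some perturbation has O(1) such cells, so the bad shocks lie in
    O(1) intervals of length O(1/N), and this persists under changes of the
    signal of size O(1/N) in sup norm. *)

Set Implicit Arguments.
Unset Strict Implicit.
Unset Printing Implicit Defensive.

(** * Integrals over open intervals *)

Section open_interval_integrals.
Context {R : realType}.
Notation mu := (@lebesgue_measure R).
Implicit Types (f g : R -> R) (x y : R).

Lemma integrable_Iab f x y M :
  {in Iab x y, continuous f} -> (forall s, Iab x y s -> `|f s| <= M) ->
  mu.-integrable (Iab x y) (EFin \o f).
Proof.
move=> cf fM; apply: measurable_bounded_integrable.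
- exact: measurable_itv.
- by have /= -> := lebesgue_measure_itv `]x, y[; case: ifP => // _; rewrite -EFinB ltry.
- apply: subspace_continuous_measurable_fun; first exact: measurable_itv.
  exact: continuous_in_subspaceT.
- exists M; split; first exact: num_real.
  by move=> N MN s /fM sM; exact: (le_trans sM (ltW MN)).
Qed.

Lemma Rintegral_Iab_norm_le f x y M : x <= y ->
  mu.-integrable (Iab x y) (EFin \o f) ->
  (forall s, Iab x y s -> `|f s| <= M) ->
  `|\int[mu]_(s in Iab x y) f s| <= M * (y - x).
Proof.
move=> xy intf fM.
apply: (le_trans (le_normr_Rintegral _ intf)); first exact: measurable_itv.
apply: (@le_trans _ _ (\int[mu]_(s in Iab x y) M)).
  apply: le_Rintegral => //; first exact: measurable_itv.
    exact: integrable_norm.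
  apply: (@integrable_Iab _ _ _ `|M|) => //.
  by move=> s _; exact: cvg_cst.
rewrite Rintegral_cst; last exact: measurable_itv.
have /= -> := lebesgue_measure_itv `]x, y[; rewrite lte_fin; case: ltP => //= yx.
by rewrite (@le_anti _ _ x y) ?xy ?yx// subrr.
Qed.

Lemma Rintegral_Iab_split f x y z : x < y < z ->
  mu.-integrable (Iab x z) (EFin \o f) ->
  \int[mu]_(s in Iab x z) f s =
  \int[mu]_(s in Iab x y) f s + \int[mu]_(s in Iab y z) f s.
Proof.
move=> /andP[xy yz] intf.
rewrite -(@Rintegral_itvB _ f (BRight x) (BLeft z) y)//; last by rewrite bnd_simp ltW.
rewrite [in X in _ = X + _]Rintegral_itv_bndo_bndc; first by rewrite addrC subrK.
apply: integrableS intf; [exact: measurable_itv|exact: measurable_itv|].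
by apply: subset_itvl; rewrite bnd_simp ltW.
Qed.

(** The explicit integrals below go through polynomial antiderivatives. The fundamental theorem is
    applied on [[x, y]]; the two added endpoints are null. *)
Lemma Rintegral_Iab_deriv (P : {poly R}) x y : x <= y ->
  \int[mu]_(s in Iab x y) P^`().[s] = P.[y] - P.[x].
Proof.
rewrite le_eqVlt => /predU1P[->|xy].
  by rewrite /Iab set_itvoo0 Rintegral_set0 subrr.
have cP' : {in Iab x y, continuous (horner P^`())}.
  by move=> s _; exact: continuous_horner.
have iP : mu.-integrable `[x, y] (EFin \o horner P^`()).
  apply: continuous_compact_integrable; first exact: segment_compact.
  by apply: continuous_subspaceT; exact: continuous_horner.
rewrite /Iab Rintegral_itv_bndo_bndc; last first.
  apply: integrableS iP; [exact: measurable_itv|exact: measurable_itv|].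
  exact: subset_itv_oo_cc.
rewrite Rintegral_itv_obnd_cbnd; last first.
  apply: integrableS iP; [exact: measurable_itv|exact: measurable_itv|].
  exact: subset_itv_oc_cc.
rewrite /Rintegral (@continuous_FTC2 _ _ (horner P))//.
- by apply: continuous_subspaceT; exact: continuous_horner.
- split.
  + by move=> s _; exact: derivable_horner.
  + by apply: cvg_at_right_filter; exact: continuous_horner.
  + by apply: cvg_at_left_filter; exact: continuous_horner.
- by move=> s _; rewrite derivE.
Qed.

End open_interval_integrals.

(** * Signals, tails and perturbations *)

Section signals.
Context {R : realType} {a b : R}.
Hypotheses (a0 : 0 <= a) (ab : a < b) (b1 : b <= 1).
Notation mu := (@lebesgue_measure R).
Implicit Types (f g : R -> R) (x y z s : R).

Local Ltac lra_ab := move: (a0) (ab) (b1) => *; lra.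

(** The density under state B minus the density under state A: f(1-s)/s - f = f(1-2s)/s. *)
Definition wgt f s : R := f s * (1 - 2 * s) / s.

(* Integrating from the right end avoids the singular weight 1/s when a = 0: the
   integral over (a,x) is not controlled by the sup norm of f, [tail] is. *)
Definition tail b f x : R := \int[mu]_(s in Iab x b) wgt f s.

Lemma IabP x y s : Iab x y s <-> x < s < y.
Proof. by rewrite /Iab /= in_itv. Qed.

Lemma sub_Iab x y z t : z <= x -> y <= t -> Iab x y `<=` Iab z t.
Proof. by move=> zx yt s /IabP/andP[? ?]; apply/IabP; apply/andP; split; lra_ab. Qed.

Lemma continuous_wgt f : {in Iab a b, continuous f} ->
  {in Iab a b, continuous (wgt f)}.
Proof.
move=> cf s sab; have /IabP/andP[sa _] : Iab a b s by move: sab; rewrite inE.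
have s0 : s != 0 by rewrite gt_eqF// (le_lt_trans a0).
apply: cvgM; last by apply: cvgV => //; exact: cvg_id.
apply: cvgM; first exact: cf.
by apply: cvgB; [exact: cvg_cst|apply: cvgM; [exact: cvg_cst|exact: cvg_id]].
Qed.

(** Since f(s)(1-s)/s and [wgt f] differ by the bounded f, their bounds can be traded; both
    integrands are then bounded and continuous, so extended integrals become real ones. *)
Lemma signalP f : signal_space a b f <->
  [/\ {in Iab a b, continuous f},
      exists M : R, forall s, Iab a b s -> `|f s| <= M,
      forall s, Iab a b s -> 0 <= f s,
      exists M : R, forall s, Iab a b s -> `|wgt f s| <= M &
      \int[mu]_(s in Iab a b) f s = 1 /\ tail b f a = 0].
Proof.
have wE s : Iab a b s -> f s * (1 - s) / s = wgt f s + f s.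
  move=> /IabP/andP[sa _]; rewrite /wgt; field.
  by rewrite gt_eqF// (le_lt_trans a0).
have oab : open (Iab a b) by exact: interval_open.
have mab : measurable (Iab a b) by exact: measurable_itv.
have RE g M : {in Iab a b, continuous g} -> (forall s, Iab a b s -> `|g s| <= M) ->
    (\int[mu]_(s in Iab a b) (g s)%:E = (\int[mu]_(s in Iab a b) g s)%:E)%E.
  by move=> cg gM; rewrite /Rintegral fineK//; apply: integrable_fin_num => //;
    exact: integrable_Iab cg gM.
rewrite /signal_space/= continuous_open_subspace//; split.
  move=> [cf [[M fM] [f0 [[N fN] [f1 f2]]]]].
  have wMN s : Iab a b s -> `|wgt f s| <= M + N.
    move=> sab; have := fM _ sab; have := fN _ sab; rewrite wE// => ? ?.
    rewrite (_ : wgt f s = (wgt f s + f s) - f s); last by ring.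
    by apply: (le_trans (ler_normB _ _)); rewrite addrC lerD.
  split => //; [by exists M|by exists (M + N)|split; apply: EFin_inj].
    by rewrite -(RE _ _ cf fM).
  by rewrite /tail -(RE _ _ (continuous_wgt cf) wMN).
move=> [cf [M fM] f0 [N fN] [f1 f2]]; split => //; split; first by exists M.
split => //; split; last by
  rewrite (RE _ _ cf fM) f1; split => //;
  have := RE _ _ (continuous_wgt cf) fN;
  rewrite /wgt => ->; rewrite -/(tail b f a) f2.
exists (N + M) => s sab; rewrite wE//.
by apply: (le_trans (ler_normD _ _)); rewrite lerD ?fM ?fN.
Qed.

Lemma integrable_wgt f x y : signal_space a b f -> a <= x -> y <= b ->
  mu.-integrable (Iab x y) (EFin \o wgt f).
Proof.
move=> /signalP[cf _ _ [N fN] _] ax yb.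
apply: (@integrableS _ _ _ mu (Iab a b)); [exact: measurable_itv..|exact: sub_Iab|].
exact: (integrable_Iab (continuous_wgt cf) fN).
Qed.

(** The total integral of [wgt f] is zero, so its part left of [mcut] is minus the tail there. *)
Lemma Gf_tail f p u v lam c : signal_space a b f ->
  Iab a b (mcut u lam c) -> Iab a b (mmcut v lam c) ->
  Gf p u v a b f lam c =
  (1 - p) * tail b f (mmcut v lam c) - p * tail b f (mcut u lam c).
Proof.
move=> Xf /IabP mab _; have /signalP[_ _ _ _ [_ f0]] := Xf.
have := @Rintegral_Iab_split _ _ _ _ _ mab (integrable_wgt Xf (lexx _) (lexx _)).
rewrite /tail in f0 *; rewrite f0 => /eqP; rewrite eq_sym addr_eq0 => /eqP E.
by rewrite /Gf -/(wgt f) E; rewrite /wgt; ring.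
Qed.

Lemma norm_wgt_le f s : 0 < s < 1 -> `|wgt f s| <= `|f s| / s.
Proof.
move=> /andP[s0 s1]; rewrite /wgt !normrM normfV (gtr0_norm s0).
rewrite ler_pM2r ?invr_gt0// ler_piMr// ler_norml; apply/andP; split; lra_ab.
Qed.

(** On (x,b) the factor |1-2s|/s is at most 1/z and the length is at most 1; the lower bound z
    controls 1/s even when [a = 0]. *)
Lemma tail_dist f g (r : R) x z : signal_space a b f -> signal_space a b g ->
  (forall s, Iab a b s -> `|f s - g s| <= r) -> a <= z -> 0 < z -> z <= x < b ->
  `|tail b f x - tail b g x| <= r / z.
Proof.
move=> Xf Xg fg az z0 /andP[zx xb].
have ax : a <= x by lra_ab.
have iw h : signal_space a b h -> mu.-integrable (Iab x b) (EFin \o wgt h).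
  by move=> Xh; exact: integrable_wgt.
rewrite /tail -RintegralB ?iw//; last exact: measurable_itv.
have wB s : wgt f s - wgt g s = wgt (fun s => f s - g s) s by rewrite /wgt; ring.
have r0 : 0 <= r.
  have xab : Iab a b ((x + b) / 2) by apply/IabP; apply/andP; split; lra_ab.
  by apply: le_trans (fg _ xab).
have rz : 0 <= r / z by rewrite divr_ge0// ltW.
apply: (@le_trans _ _ (r / z * (b - x))); last first.
  have bx : b - x <= 1 by lra_ab.
  by rewrite ler_piMr.
apply: Rintegral_Iab_norm_le; first exact: ltW.
  have -> : EFin \o (fun s => wgt f s - wgt g s) =
    ((EFin \o wgt f) \- (EFin \o wgt g))%E by apply/funext.
  by apply: integrableB; [exact: measurable_itv|exact: iw|exact: iw].
move=> s /IabP/andP[xs sb]; rewrite wB.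
apply: (le_trans (norm_wgt_le _ _)); first by apply/andP; split; lra_ab.
apply: ler_pM => //; [by rewrite invr_ge0; lra_ab| |].
  by apply: fg; apply/IabP/andP; split; lra_ab.
by rewrite lef_pV2 ?posrE; lra_ab.
Qed.

Lemma tail_lip f (B : R) x y z : signal_space a b f ->
  (forall s, Iab a b s -> `|f s| <= B) -> a <= z -> 0 < z ->
  z <= x < b -> z <= y < b ->
  `|tail b f x - tail b f y| <= B / z * `|x - y|.
Proof.
move=> Xf fB az z0; wlog xy : x y / x < y => [wl xb yb|].
  have [/wl|/wl|->] := ltgtP x y; [exact| |by rewrite !subrr !normr0 mulr0].
  by rewrite distrC (distrC x); exact.
move=> /andP[zx xb] /andP[zy yb].
rewrite /tail (@Rintegral_Iab_split _ _ x y b) ?xy//; last first.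
  by apply: integrable_wgt => //; lra_ab.
rewrite addrK distrC (gtr0_norm (_ : 0 < y - x)); last by lra_ab.
apply: Rintegral_Iab_norm_le; first exact: ltW.
  by apply: integrable_wgt => //; lra_ab.
move=> s /IabP/andP[xs sb].
apply: (le_trans (norm_wgt_le _ _)); first by apply/andP; split; lra_ab.
apply: ler_pM => //; [by rewrite invr_ge0; lra_ab| |].
  by apply: fB; apply/IabP/andP; split; lra_ab.
by rewrite lef_pV2 ?posrE; lra_ab.
Qed.

Lemma signal_mix f g (t : R) : signal_space a b f -> signal_space a b g ->
  0 <= t <= 1 -> signal_space a b (fun s => (1 - t) * f s + t * g s).
Proof.
move=> Xf Xg /andP[t0 t1].
have /signalP[cf [M fM] f0 [N fN] [f1 f2]] := Xf.
have /signalP[cg [M' gM] g0 [N' gN] [g1 g2]] := Xg.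
have bnd (F G : R -> R) K K' : (forall s, Iab a b s -> `|F s| <= K) ->
    (forall s, Iab a b s -> `|G s| <= K') ->
    forall s, Iab a b s -> `|(1 - t) * F s + t * G s| <= (1 - t) * K + t * K'.
  move=> FK GK s sab; apply: (le_trans (ler_normD _ _)).
  rewrite !normrM (ger0_norm t0) (ger0_norm (_ : 0 <= 1 - t)); last by lra_ab.
  by rewrite lerD// ler_wpM2l ?FK ?GK//; lra_ab.
have mab : measurable (Iab a b) by exact: measurable_itv.
have wE s : wgt (fun s => (1 - t) * f s + t * g s) s =
    (1 - t) * wgt f s + t * wgt g s by rewrite /wgt; ring.
have intE (F G : R -> R) : mu.-integrable (Iab a b) (EFin \o F) ->
    mu.-integrable (Iab a b) (EFin \o G) ->
    \int[mu]_(s in Iab a b) ((1 - t) * F s + t * G s) =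
    (1 - t) * \int[mu]_(s in Iab a b) F s + t * \int[mu]_(s in Iab a b) G s.
  move=> iF iG; rewrite RintegralD ?RintegralZl//.
    by apply: (@integrableZl _ _ _ mu (Iab a b) mab (1 - t) _ iF).
  by apply: (@integrableZl _ _ _ mu (Iab a b) mab t _ iG).
apply/signalP; split.
- by move=> s sab; apply: cvgD; apply: cvgM; by [exact: cvg_cst|exact: cf|exact: cg].
- by exists ((1 - t) * M + t * M'); exact: bnd.
- by move=> s sab; rewrite addr_ge0// mulr_ge0 ?f0 ?g0//; lra_ab.
- exists ((1 - t) * N + t * N') => s sab; rewrite wE; exact: (bnd (wgt f) (wgt g)).
- split.
    by rewrite intE ?f1 ?g1; [ring|exact: integrable_Iab cf fM|exact: integrable_Iab cg gM].
  rewrite /tail; under eq_Rintegral do rewrite wE.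
  rewrite intE; [|exact: integrable_wgt..].
  by rewrite -/(tail b f a) -/(tail b g a) f2 g2; ring.
Qed.

Lemma tail_mix f g (t : R) x : signal_space a b f -> signal_space a b g -> a <= x ->
  tail b (fun s => (1 - t) * f s + t * g s) x = (1 - t) * tail b f x + t * tail b g x.
Proof.
move=> Xf Xg ax; rewrite /tail.
have mx : measurable (Iab x b) by exact: measurable_itv.
have iw h : signal_space a b h -> mu.-integrable (Iab x b) (EFin \o wgt h).
  by move=> Xh; exact: integrable_wgt.
rewrite -!RintegralZl ?iw// -RintegralD//; first last.
- exact: (@integrableZl _ _ _ mu _ mx t _ (iw _ Xg)).
- exact: (@integrableZl _ _ _ mu _ mx (1 - t) _ (iw _ Xf)).
by apply: eq_Rintegral => s _; rewrite /wgt; ring.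
Qed.

(* When q vanishes to order two at a and b, adding [tilt q] to a signal preserves
   both integral constraints; [tilt_tail q] is the antiderivative of its weighted
   density q''(s)(1-2s). *)
Definition tilt (q : {poly R}) s : R := s * q^`()^`().[s].

Definition tilt_tail (q : {poly R}) x : R := q^`().[x] * (1 - 2 * x) + 2 * q.[x].

Lemma wgt_tilt q s : 0 < s -> wgt (tilt q) s = q^`()^`().[s] * (1 - 2 * s).
Proof. by move=> s0; rewrite /wgt /tilt; field; rewrite gt_eqF. Qed.

Definition flat_ends (q : {poly R}) :=
  [/\ q.[a] = 0, q^`().[a] = 0, q.[b] = 0 & q^`().[b] = 0].

Lemma poly_bounded (q : {poly R}) :
  exists2 M : R, 0 < M & forall s, Iab a b s -> `|q.[s]| <= M.
Proof.
have [|c _ cM] := @EVT_max _ (fun s => `|q.[s]|) a b (ltW ab).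
  apply: continuous_subspaceT => s.
  by apply: (@continuous_comp _ _ _ (horner q));
    [exact: continuous_horner|exact: norm_continuous].
exists (`|q.[c]| + 1); first by rewrite ltr_wpDl.
move=> s /IabP/andP[? ?]; apply: (le_trans (cM s _)).
  by rewrite in_itv/=; apply/andP; split; lra_ab.
by rewrite lerDl.
Qed.

(** In the derivative of [tilt_tail q] the term -2q' from the product rule cancels 2q', leaving
    q''(s)(1-2s); the value at b vanishes. *)
Lemma Rintegral_wgt_tilt q x : a <= x <= b -> q.[b] = 0 -> q^`().[b] = 0 ->
  \int[mu]_(s in Iab x b) wgt (tilt q) s = - tilt_tail q x.
Proof.
move=> /andP[ax xb] qb q'b.
pose P := q^`() * (1%:P - 2%:P * 'X) + 2%:P * q.
have PE z : P.[z] = tilt_tail q z by rewrite /P /tilt_tail !hornerE.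
have dP z : P^`().[z] = q^`()^`().[z] * (1 - 2 * z).
  by rewrite /P !(derivD, derivN, derivM, derivC, derivX)
    !(hornerD, hornerN, hornerM, hornerC, hornerX); ring.
rewrite (@eq_Rintegral _ _ _ mu _ (horner P^`())); last first.
  move=> s; rewrite inE => /IabP/andP[xs _].
  by rewrite wgt_tilt ?dP//; lra_ab.
by rewrite Rintegral_Iab_deriv// !PE /tilt_tail qb q'b; ring.
Qed.

(** The integrand s q''(s) has the antiderivative s q'(s) - q(s), which vanishes at both ends. *)
Lemma Rintegral_tilt q : flat_ends q -> \int[mu]_(s in Iab a b) tilt q s = 0.
Proof.
move=> [qa q'a qb q'b]; pose P := 'X * q^`() - q.
have PE z : P.[z] = z * q^`().[z] - q.[z] by rewrite /P !hornerE.
have dP z : P^`().[z] = tilt q z.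
  by rewrite /P !(derivD, derivN, derivM, derivC, derivX)
    !(hornerD, hornerN, hornerM, hornerC, hornerX) /tilt; ring.
under eq_Rintegral do rewrite -dP.
by rewrite Rintegral_Iab_deriv ?ltW// !PE qa q'a qb q'b; ring.
Qed.

Lemma continuous_tilt q : continuous (tilt q).
Proof. by move=> s; apply: cvgM; [exact: cvg_id|exact: continuous_horner]. Qed.

Lemma integrable_tilt q : mu.-integrable (Iab a b) (EFin \o tilt q).
Proof.
have [M M0 qM] := poly_bounded q^`()^`().
apply: (@integrable_Iab _ _ _ _ M) => [s _|s sab]; first exact: continuous_tilt.
have /IabP/andP[? ?] := sab; rewrite /tilt normrM; apply: le_trans (qM _ sab).
by rewrite ler_piMl//  gtr0_norm; lra_ab.
Qed.

Lemma integrable_wgt_tilt q x : a <= x ->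
  mu.-integrable (Iab x b) (EFin \o wgt (tilt q)).
Proof.
move=> ax.
have [M M0 qM] := poly_bounded q^`()^`().
apply: (@integrableS _ _ _ mu (Iab a b)); [exact: measurable_itv..|exact: sub_Iab|].
apply: (@integrable_Iab _ _ _ _ M) => [|s sab].
  by apply: continuous_wgt => s _; exact: continuous_tilt.
have /IabP/andP[? ?] := sab; rewrite wgt_tilt; last by lra_ab.
rewrite normrM; apply: le_trans (qM _ sab).
by rewrite ler_piMr// ler_norml; apply/andP; split; lra_ab.
Qed.

(** Nonnegativity survives because |tilt q s| = s|q''(s)| stays below g(s). This is why a signal
    bounded below by a multiple of s is constructed later. *)
Lemma signal_tilt g q : signal_space a b g -> flat_ends q ->
  (forall s, Iab a b s -> s * `|q^`()^`().[s]| <= g s) ->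
  signal_space a b (fun s => g s + tilt q s).
Proof.
move=> Xg qab qg; have [qa q'a qb q'b] := qab.
have /signalP[cg [M gM] g0 [N gN] [g1 g2]] := Xg.
have [K K0 qK] := poly_bounded q^`()^`().
have wE s : wgt (fun s => g s + tilt q s) s = wgt g s + wgt (tilt q) s.
  by rewrite /wgt; ring.
have mab : measurable (Iab a b) by exact: measurable_itv.
apply/signalP; split.
- by move=> s sab; apply: cvgD; [exact: cg|exact: continuous_tilt].
- exists (M + K) => s sab; have /IabP/andP[? ?] := sab.
  apply: (le_trans (ler_normD _ _)); rewrite lerD ?gM//.
  rewrite /tilt normrM; apply: le_trans (qK _ sab).
  by rewrite ler_piMl// gtr0_norm; lra_ab.
- move=> s sab; have /IabP/andP[? _] := sab; have := qg _ sab.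
  have : - `|tilt q s| <= tilt q s by rewrite lerNl ler_normr lexx orbT.
  by rewrite /tilt normrM gtr0_norm; lra_ab.
- exists (N + K) => s sab; have /IabP/andP[? ?] := sab.
  rewrite wE; apply: (le_trans (ler_normD _ _)); rewrite lerD ?gN//.
  rewrite wgt_tilt; last by lra_ab.
  rewrite normrM; apply: le_trans (qK _ sab).
  by rewrite ler_piMr// ler_norml; apply/andP; split; lra_ab.
- split.
    rewrite RintegralD ?g1 ?Rintegral_tilt ?addr0//.
      exact: integrable_Iab cg gM.
    exact: integrable_tilt.
  rewrite /tail; under eq_Rintegral do rewrite wE.
  rewrite RintegralD//; [|exact: integrable_wgt|exact: integrable_wgt_tilt].
  rewrite -/(tail b g a) g2 Rintegral_wgt_tilt ?lexx ?ltW//.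
  by rewrite /tilt_tail qa q'a; ring.
Qed.

Lemma tail_tilt g q x : signal_space a b g -> flat_ends q -> a <= x <= b ->
  tail b (fun s => g s + tilt q s) x = tail b g x - tilt_tail q x.
Proof.
move=> Xg [qa q'a qb q'b] /andP[ax xb].
rewrite -Rintegral_wgt_tilt ?ax//.
rewrite -RintegralD; [|exact: measurable_itv|exact: integrable_wgt|exact: integrable_wgt_tilt].
by apply: eq_Rintegral => s _; rewrite /wgt; ring.
Qed.

End signals.
Arguments flat_ends {R} a b q.

(** * A signal bounded below by a multiple of s *)

Section positive_signal.
Context {R : realType} {a b : R}.
Hypotheses (a0 : 0 <= a) (ab : a < b) (b1 : b <= 1).
Notation mu := (@lebesgue_measure R).
Implicit Types (f g : R -> R) (x y z s : R).

Local Ltac lra_ab := move: (a0) (ab) (b1) => *; lra.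

(** The integral of |wgt f| is e times 0, so [wgt f] vanishes almost everywhere; dividing by the
    nonzero (1-2s)/s, so does f, against its total mass 1. *)
Lemma signal_wgt_sign f (e : R) : signal_space a b f ->
  (forall s, Iab a b s -> 1 - 2 * s != 0) ->
  (forall s, Iab a b s -> `|wgt f s| = e * wgt f s) -> False.
Proof.
move=> Xf w0 fe; have /(signalP a0)[cf [M fM] f0 _ [f1 f2]] := Xf.
have mab : measurable (Iab a b) by exact: measurable_itv.
have iw := integrable_wgt a0 ab b1 Xf (lexx _) (lexx _).
have iF := integrable_Iab cf fM.
have : (\int[mu]_(s in Iab a b) `|(EFin \o wgt f) s| = 0)%E.
  transitivity (\int[mu]_(s in Iab a b) (e%:E * (wgt f s)%:E))%E.
    by apply: eq_integral => s; rewrite inE => sab; rewrite /= fe.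
  rewrite integralZl//.
  have -> : (\int[mu]_(s in Iab a b) (wgt f s)%:E)%E = (tail b f a)%:E.
    by rewrite /tail /Rintegral fineK//; exact: integrable_fin_num.
  by rewrite f2 mule0.
move=> /(ae_eq_integral_abs mu mab (measurable_int _ iw)).1 wae.
have fae : ae_eq mu (Iab a b) (EFin \o f) (cst 0%E).
  apply: filterS wae => s /= H sab; have [ws] := H sab.
  have /IabP/andP[sa _] := sab; congr EFin.
  have s0 : s^-1 != 0 by rewrite invr_eq0 gt_eqF//; lra_ab.
  move/eqP: ws; rewrite /wgt !mulf_eq0 (negbTE (w0 _ sab)) (negbTE s0) !orbF.
  by move/eqP.
have := (ae_eq_integral_abs mu mab (measurable_int _ iF)).2 fae.
move=> /(congr1 fine).
have -> : fine (\int[mu]_(s in Iab a b) `|(EFin \o f) s|)%E =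
    \int[mu]_(s in Iab a b) f s.
  congr fine; apply: eq_integral => s; rewrite inE => sab /=.
  by rewrite ger0_norm// f0.
by rewrite f1 /= => /eqP; rewrite oner_eq0.
Qed.

(** Were 1/2 outside (a,b), the factor 1-2s would keep one strict sign there, and [signal_wgt_sign]
    applies with e that sign. *)
Lemma signal_half f : signal_space a b f -> a < 1 / 2 < b.
Proof.
move=> Xf; have /(signalP a0)[_ _ f0 _ _] := Xf.
have [ha|ha] := ltP a (1 / 2); last first.
  exfalso; apply: (@signal_wgt_sign f (-1) Xf) => s /[dup] sab /IabP/andP[sa sb].
    by rewrite lt_eqF//; lra_ab.
  rewrite mulN1r ler0_norm// /wgt -mulrA mulr_ge0_le0 ?f0//.
  by rewrite pmulr_lle0 ?invr_gt0; lra_ab.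
have [hb|//] := leP b (1 / 2).
exfalso; apply: (@signal_wgt_sign f 1 Xf) => s /[dup] sab /IabP/andP[sa sb].
  by rewrite gt_eqF//; lra_ab.
rewrite mul1r ger0_norm// /wgt -mulrA mulr_ge0 ?f0//.
by rewrite pmulr_lge0 ?invr_gt0; lra_ab.
Qed.

(* Twice the positive part of s - 1/2 for e = 1, of 1/2 - s for e = -1. *)
Definition ramp (e s : R) : R := `|s - 1 / 2| + e * (s - 1 / 2).

Lemma continuous_ramp e : continuous (ramp e).
Proof.
move=> s; apply: cvgD.
  apply: (@continuous_comp _ _ _ (fun s => s - 1 / 2)); last exact: norm_continuous.
  by apply: cvgB; [exact: cvg_id|exact: cvg_cst].
by apply: cvgM; [exact: cvg_cst|apply: cvgB; [exact: cvg_id|exact: cvg_cst]].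
Qed.

Lemma ramp_bounds e s : `|e| <= 1 -> Iab a b s -> 0 <= ramp e s <= 2.
Proof.
move=> e1 /IabP/andP[sa sb].
have : `|e * (s - 1 / 2)| <= `|s - 1 / 2| by rewrite normrM ler_piMl.
have : `|s - 1 / 2| <= 1 by rewrite ler_norml; apply/andP; split; lra_ab.
rewrite /ramp => h /ler_normlP[h1 h2]; apply/andP; split; lra.
Qed.

Lemma integrable_ramp e (w : R -> R) : `|e| <= 1 -> continuous w ->
  (forall s, Iab a b s -> `|w s| <= 1) ->
  mu.-integrable (Iab a b) (EFin \o (fun s => ramp e s * w s)).
Proof.
move=> e1 cw w1; apply: (@integrable_Iab _ _ _ _ 2).
  by move=> s _; apply: cvgM; [exact: continuous_ramp|exact: cw].
move=> s sab; have /andP[r0 r2] := ramp_bounds e1 sab.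
by rewrite normrM (ger0_norm r0) -[leRHS]mulr1 ler_pM ?w1.
Qed.

(** The ramp is (1-e)(1/2-s) left of 1/2 and (1+e)(s-1/2) right of it, so each half of the integrand
    is a multiple of (s-1/2)^2. *)
Lemma Rintegral_ramp e : `|e| <= 1 -> a < 1 / 2 < b ->
  \int[mu]_(s in Iab a b) (ramp e s * (1 - 2 * s)) =
  2 / 3 * ((1 - e) * (1 / 2 - a) ^+ 3 - (1 + e) * (b - 1 / 2) ^+ 3).
Proof.
move=> e1 hab; have /andP[ha hb] := hab.
rewrite (@Rintegral_Iab_split _ _ a (1 / 2) b)//; last first.
  apply: integrable_ramp => //.
    by move=> s; apply: cvgB; [exact: cvg_cst|apply: cvgM; [exact: cvg_cst|exact: cvg_id]].
  by move=> s /IabP/andP[? ?]; rewrite ler_norml; apply/andP; split; lra_ab.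
pose c : {poly R} := 'X - (1 / 2)%:P.
have H k x y : x <= y -> \int[mu]_(s in Iab x y) (k * (s - 1 / 2) ^+ 2) =
    k / 3 * ((y - 1 / 2) ^+ 3 - (x - 1 / 2) ^+ 3).
  move=> xy; pose P := (k / 3)%:P * (c * c * c).
  transitivity (\int[mu]_(s in Iab x y) P^`().[s]).
    apply: eq_Rintegral => s _; rewrite /P /c.
    rewrite !(derivD, derivN, derivM, derivC, derivX).
    by rewrite !(hornerD, hornerN, hornerM, hornerC, hornerX); field.
  rewrite Rintegral_Iab_deriv// /P /c !(hornerD, hornerN, hornerM, hornerC, hornerX).
  by field.
rewrite (@eq_Rintegral _ _ _ mu _ (fun s => 2 * (1 - e) * (s - 1 / 2) ^+ 2)); last first.
  move=> s; rewrite inE => /IabP/andP[_ sh]; rewrite /ramp ler0_norm; last by lra.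
  by field.
rewrite [X in _ + X](@eq_Rintegral _ _ _ mu _
    (fun s => - 2 * (1 + e) * (s - 1 / 2) ^+ 2)); last first.
  move=> s; rewrite inE => /IabP/andP[sh _]; rewrite /ramp ger0_norm; last by lra.
  by field.
by rewrite !H ?ltW//; field.
Qed.

(** The signal is chi(s)s/n with chi = 1 + K ramp. Its weighted density is chi(s)(1-2s)/n, so K and
    e have one integral to balance; n normalizes the mass, and chi >= 1 gives eta = 1/n. *)
Lemma positive_signal : a < 1 / 2 < b ->
  exists (g : R -> R) (eta : R), [/\ signal_space a b g, 0 < eta &
    forall s, Iab a b s -> eta * s <= g s].
Proof.
move=> hab; have /andP[ha hb] := hab.
pose I : R := \int[mu]_(s in Iab a b) (1 - 2 * s).
(* The choice e = 1 adds mass right of 1/2, where 1-2s < 0, and so corrects a nonnegative I; e = -1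
   corrects a negative one. *)
have [e [e1 [K [K0 EK]]]] : exists e : R, `|e| <= 1 /\ exists K : R, 0 <= K /\
    I + K * \int[mu]_(s in Iab a b) (ramp e s * (1 - 2 * s)) = 0.
  have [I0|I0] := leP 0 I.
    exists 1; split; first by rewrite normr1.
    rewrite Rintegral_ramp ?normr1//.
    exists (I / (4 / 3 * (b - 1 / 2) ^+ 3)).
    have J0 : 0 < (b - 1 / 2) ^+ 3 by rewrite exprn_gt0//; lra.
    split; first by rewrite divr_ge0//; lra.
    by rewrite subrr mul0r; field; rewrite gt_eqF//; lra.
  exists (-1); split; first by rewrite normrN1.
  rewrite Rintegral_ramp ?normrN1//.
  exists (- I / (4 / 3 * (1 / 2 - a) ^+ 3)).
  have J0 : 0 < (1 / 2 - a) ^+ 3 by rewrite exprn_gt0//; lra.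
  split; first by rewrite divr_ge0//; lra.
  by rewrite subrr mul0r; field; rewrite gt_eqF//; lra.
pose chi s := 1 + K * ramp e s.
have cchi : continuous chi.
  move=> s; apply: cvgD; first exact: cvg_cst.
  by apply: cvgM; [exact: cvg_cst|exact: continuous_ramp].
have chi1 s : Iab a b s -> 1 <= chi s <= 1 + 2 * K.
  move=> sab; have /andP[r0 r2] := ramp_bounds e1 sab.
  rewrite /chi lerDl mulr_ge0//= lerD2l mulrC.
  exact: ler_wpM2r.
have cid : continuous (fun s : R => s) by move=> s; exact: cvg_id.
have cw : continuous (fun s : R => 1 - 2 * s).
  by move=> s; apply: cvgB; [exact: cvg_cst|apply: cvgM; [exact: cvg_cst|exact: cvg_id]].
have w1 s : Iab a b s -> `|1 - 2 * s| <= 1.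
  by move=> /IabP/andP[? ?]; rewrite ler_norml; apply/andP; split; lra_ab.
have chiB s (w : R -> R) : Iab a b s -> `|w s| <= 1 -> `|chi s * w s| <= 1 + 2 * K.
  move=> sab ws; have /andP[c1 c2] := chi1 s sab.
  by rewrite normrM ger0_norm -1?[leRHS]mulr1 ?ler_pM//; lra.
pose n := \int[mu]_(s in Iab a b) (chi s * s).
have mab : measurable (Iab a b) by exact: measurable_itv.
have ichi : mu.-integrable (Iab a b) (EFin \o (fun s => chi s * s)).
  apply: (@integrable_Iab _ _ _ _ (1 + 2 * K)).
    by move=> s _; apply: cvgM; [exact: cchi|exact: cvg_id].
  move=> s sab; apply: (chiB s id) => //; have /IabP/andP[? ?] := sab.
  by rewrite gtr0_norm; lra_ab.
have n0 : 0 < n.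
  apply: (@lt_le_trans _ _ (\int[mu]_(s in Iab a b) s)).
    have -> : \int[mu]_(s in Iab a b) s = (b ^+ 2 - a ^+ 2) / 2.
      pose Q : {poly R} := (1 / 2)%:P * ('X * 'X).
      transitivity (\int[mu]_(s in Iab a b) Q^`().[s]).
        apply: eq_Rintegral => s _; rewrite /Q !(derivM, derivC, derivX).
        by rewrite !(hornerD, hornerM, hornerC, hornerX); field.
      rewrite Rintegral_Iab_deriv ?ltW// /Q !(hornerM, hornerC, hornerX).
      by field.
    rewrite subr_sqr; apply: divr_gt0 => //; apply: mulr_gt0; lra_ab.
  apply: le_Rintegral => //.
    by apply: (@integrable_Iab _ _ _ _ 1) => [s _|s /IabP/andP[? ?]];
      [exact: cvg_id|rewrite gtr0_norm; lra_ab].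
  move=> s sab; have /andP[c1 _] := chi1 s sab; have /IabP/andP[? ?] := sab.
  by rewrite ler_peMl//; lra_ab.
have wE s : Iab a b s -> wgt (fun s => n^-1 * (chi s * s)) s =
    n^-1 * (chi s * (1 - 2 * s)).
  move=> /IabP/andP[? ?]; rewrite /wgt; field.
  by apply/andP; split; rewrite gt_eqF//; lra_ab.
exists (fun s => n^-1 * (chi s * s)), n^-1.
split; rewrite ?invr_gt0//; last first.
  move=> s sab; have /andP[c1 _] := chi1 s sab; have /IabP/andP[? ?] := sab.
  by rewrite ler_pM2l ?invr_gt0// ler_peMl//; lra_ab.
apply/(signalP a0); split.
- move=> s _; apply: cvgM; first exact: cvg_cst.
  by apply: cvgM; [exact: cchi|exact: cvg_id].
- exists (n^-1 * (1 + 2 * K)) => s sab; have /IabP/andP[? ?] := sab.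
  rewrite normrM gtr0_norm ?invr_gt0// ler_pM2l ?invr_gt0//.
  by apply: (chiB s id) => //; rewrite gtr0_norm; lra_ab.
- move=> s sab; have /andP[c1 _] := chi1 s sab; have /IabP/andP[? ?] := sab.
  by rewrite !mulr_ge0 ?invr_ge0; lra_ab.
- exists (n^-1 * (1 + 2 * K)) => s sab; rewrite wE//.
  rewrite normrM gtr0_norm ?invr_gt0// ler_pM2l ?invr_gt0//.
  by apply: (chiB s (fun s => 1 - 2 * s)) => //; exact: w1.
- split; first by rewrite RintegralZl// -/n mulVf// gt_eqF.
  rewrite /tail (@eq_Rintegral _ _ _ mu _ (fun s => n^-1 * (chi s * (1 - 2 * s)))); last first.
    by move=> s; rewrite inE => /wE.
  have ir := integrable_ramp e1 cw w1.
  have i1 : mu.-integrable (Iab a b) (EFin \o (fun s => 1 - 2 * s)).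
    by apply: (@integrable_Iab _ _ _ _ 1) => // s _; exact: cw.
  rewrite RintegralZl//; last first.
    apply: (@integrable_Iab _ _ _ _ (1 + 2 * K)).
      by move=> s _; apply: cvgM; [exact: cchi|exact: cw].
    by move=> s sab; apply: (chiB s (fun s => 1 - 2 * s)) => //; exact: w1.
  rewrite (@eq_Rintegral _ _ _ mu _
    (fun s => (1 - 2 * s) + K * (ramp e s * (1 - 2 * s)))); last first.
    by move=> s _; rewrite /chi; ring.
  rewrite RintegralD//; last exact: (@integrableZl _ _ _ mu _ mab K _ ir).
  by rewrite RintegralZl// -/I EK mulr0.
Qed.

End positive_signal.

(** * Pigeonhole and elementary estimates *)

(** Double counting: closeness leaves each z at most (D+1)^2 bad p, and there are at least as many p
    as z, so the average number of bad z per p is at most (D+1)^2. *)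
Lemma pigeonhole_close (Z : finType) (n D : nat)
    (bad : Z -> 'I_n.+1 * 'I_n.+1 -> bool) : (#|Z| <= n.+1 * n.+1)%N ->
  (forall z p q, bad z p -> bad z q ->
     (p.1 <= q.1 + D)%N /\ (p.2 <= q.2 + D)%N) ->
  exists p, (#|[pred z | bad z p]| <= D.+1 * D.+1)%N.
Proof.
move=> Zn close.
(* Reduction modulo D+1 is injective on index pairs that are pairwise D-close. *)
have few z : (#|[pred p | bad z p]| <= D.+1 * D.+1)%N.
  pose m (i : 'I_n.+1) : 'I_D.+1 := inord (i %% D.+1).
  have mE (i j : 'I_n.+1) : (i <= j + D)%N -> (j <= i + D)%N -> m i = m j -> i = j.
    move=> ij ji /(congr1 val) /=; rewrite !inordK ?ltn_pmod// => e.
    apply: val_inj => /=; move: ij ji e; wlog lij : i j / (i <= j)%N => [wl|].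
      move=> ij ji e; have [/wl|/ltnW/wl] := leqP i j; first exact.
      by move=> H; rewrite H.
    move=> _ ji /esym/eqP; rewrite eqn_mod_dvd// => /dvdnP[[|k] jk].
      by apply/eqP; rewrite eqn_leq lij /= -subn_eq0 jk.
    have : (j - i < D.+1)%N by rewrite ltnS leq_subLR.
    by rewrite jk mulSn ltnNge leq_addr.
  have inj : {in [pred p | bad z p] &, injective (fun p : 'I_n.+1 * 'I_n.+1 => (m p.1, m p.2))}.
    move=> [i j] [i' j']; rewrite !inE => bp bq [/mE e1 /mE e2].
    have [/= h1 h2] := close _ _ _ bp bq; have [/= h3 h4] := close _ _ _ bq bp.
    by rewrite e1// e2.
  rewrite -(card_in_imset inj); apply: leq_trans (max_card _) _.
  by rewrite card_prod card_ord.
apply: contrapT => nex.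
have many p : (D.+1 * D.+1 < #|[pred z | bad z p]|)%N.
  by rewrite ltnNge; apply/negP => h; apply: nex; exists p.
have : (\sum_(p : 'I_n.+1 * 'I_n.+1) #|[pred z | bad z p]| <= n.+1 * n.+1 * (D.+1 * D.+1))%N.
  under eq_bigr do rewrite -sum1_card big_mkcond/=.
  rewrite exchange_big/=; apply: leq_trans (leq_mul Zn (leqnn _)).
  rewrite -sum_nat_const leq_sum// => z _; apply: leq_trans (few z).
  by rewrite -sum1_card [leqRHS]big_mkcond.
rewrite leqNgt => /negP; apply.
apply: (@leq_trans (n.+1 * n.+1 * (D.+1 * D.+1).+1)).
  by rewrite ltn_pmul2l// muln_gt0.
have -> : (n.+1 * n.+1 = #|{: 'I_n.+1 * 'I_n.+1}|)%N by rewrite card_prod card_ord.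
by rewrite -sum_nat_const leq_sum.
Qed.

Section real_lemmas.
Context {R : realType}.
Implicit Types x y : R.

(** The square of S has a double zero at each y in [ys]; the linear factor is fitted at x, [al] to
    the value and [be] to the zero slope. *)
Lemma hermite_interpolation (ys : seq R) x k : x \notin ys ->
  exists q : {poly R}, [/\ q.[x] = k, q^`().[x] = 0 &
    forall y, y \in ys -> q.[y] = 0 /\ q^`().[y] = 0].
Proof.
move=> xys; pose S : {poly R} := \prod_(y <- ys) ('X - y%:P).
have Sx : S.[x] != 0 by rewrite -rootE root_prod_XsubC.
have S0 y : y \in ys -> S.[y] = 0.
  by move=> yys; apply/eqP; rewrite -rootE root_prod_XsubC.
pose al := k / (S.[x] * S.[x]); pose be := - 2 * S^`().[x] * al / S.[x].
pose q : {poly R} := S * S * (al%:P + be%:P * ('X - x%:P)).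
have q'E y : q^`().[y] = 2 * S^`().[y] * S.[y] * (al + be * (y - x)) +
    S.[y] * S.[y] * be.
  rewrite /q !(derivD, derivN, derivM, derivC, derivX).
  by rewrite !(hornerD, hornerN, hornerM, hornerC, hornerX); ring.
have qE y : q.[y] = S.[y] * S.[y] * (al + be * (y - x)).
  by rewrite /q !(hornerD, hornerN, hornerM, hornerC, hornerX).
exists q; split.
- by rewrite qE /al /be; field.
- by rewrite q'E /be; field.
- by move=> y /S0 yS; rewrite q'E qE yS; split; ring.
Qed.

(** Over the second denominator alone, the difference is a combination of P'-P and N-N' with
    coefficients in [0,1]. *)
Lemma fraction_lip (N P N' P' nu : R) : 0 <= N -> 0 <= P -> 0 < N + P ->
  0 < nu -> nu <= N' + P' ->
  `|N / (N + P) - N' / (N' + P')| <= (`|N - N'| + `|P - P'|) / nu.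
Proof.
move=> N0 P0 D0 nu0 D'0; have D'1 : 0 < N' + P' by lra.
have -> : N / (N + P) - N' / (N' + P') =
    (N / (N + P) * (P' - P) + P / (N + P) * (N - N')) / (N' + P').
  by field; apply/andP; split; rewrite gt_eqF.
rewrite normrM normfV (gtr0_norm D'1) ler_pM ?invr_ge0 ?(ltW D'1)//; last first.
  by rewrite lef_pV2 ?posrE.
apply: (le_trans (ler_normD _ _)); rewrite [leRHS]addrC (distrC P).
have h (T : R) : 0 <= T -> T <= N + P -> `|T / (N + P)| <= 1.
  move=> T0 TD; rewrite ger0_norm; first by rewrite ler_pdivrMr ?mul1r.
  by rewrite divr_ge0// ltW.
have hN : `|N / (N + P)| <= 1 by apply: h => //; lra.
have hP : `|P / (N + P)| <= 1 by apply: h => //; lra.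
by apply: lerD; rewrite normrM ler_piMl.
Qed.

(** Both |x| and |y| are at most F + (|x|+|y|)/4; adding gives |x|+|y| <= 4F, and substituting back
    gives 2F. *)
Lemma near_identity_inverse (F x y a11 a12 a21 a22 : R) :
  `|a11 - 1| <= 1 / 4 -> `|a12| <= 1 / 4 -> `|a21| <= 1 / 4 -> `|a22 - 1| <= 1 / 4 ->
  `|x * a11 + y * a12| <= F -> `|x * a21 + y * a22| <= F ->
  `|x| <= 2 * F /\ `|y| <= 2 * F.
Proof.
move=> h11 h12 h21 h22 hx hy.
have px : `|x * (a11 - 1)| <= `|x| * (1 / 4) by rewrite normrM ler_wpM2l.
have py : `|y * a12| <= `|y| * (1 / 4) by rewrite normrM ler_wpM2l.
have px' : `|x * a21| <= `|x| * (1 / 4) by rewrite normrM ler_wpM2l.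
have py' : `|y * (a22 - 1)| <= `|y| * (1 / 4) by rewrite normrM ler_wpM2l.
have Hx : `|x| <= F + `|x| * (1 / 4) + `|y| * (1 / 4).
  rewrite {1}(_ : x = (x * a11 + y * a12) - x * (a11 - 1) - y * a12); last by ring.
  apply: (le_trans (ler_normB _ _)); rewrite lerD//.
  by apply: (le_trans (ler_normB _ _)); rewrite lerD.
have Hy : `|y| <= F + `|x| * (1 / 4) + `|y| * (1 / 4).
  rewrite {1}(_ : y = (x * a21 + y * a22) - x * a21 - y * (a22 - 1)); last by ring.
  apply: (le_trans (ler_normB _ _)); rewrite lerD//.
  by apply: (le_trans (ler_normB _ _)); rewrite lerD.
split; lra.
Qed.

Lemma grid_cell (n : nat) (x1 x2 x : R) : x1 <= x <= x2 ->
  exists i : 'I_n.+1, x1 + (x2 - x1) * i%:R / n.+1%:R <= x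
                      <= x1 + (x2 - x1) * i.+1%:R / n.+1%:R.
Proof.
move=> /andP[h1 h2]; have n0 : (0 : R) < n.+1%:R by [].
have [e|x12] := eqVneq x1 x2.
  by exists ord0; rewrite e subrr !mul0r addr0; apply/andP; split; lra.
have d0 : 0 < x2 - x1 by rewrite subr_gt0 lt_neqAle x12; lra.
(* At the right end truncation would give the index n+1, out of range; the closed last cell takes
   this point. *)
have [->|xx2] := eqVneq x x2.
  exists ord_max; rewrite /= mulfK ?gt_eqF//.
  apply/andP; split; last by lra.
  rewrite -lerBrDl ler_pdivrMr// ler_pM2l// ler_nat; exact: leqnSn.
pose t := (x - x1) / (x2 - x1) * n.+1%:R.
have t0 : 0 <= t by rewrite mulr_ge0// divr_ge0//; lra.
have tn : t < n.+1%:R.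
  rewrite -[ltRHS]mul1r ltr_pM2r// ltr_pdivrMr// mul1r.
  by rewrite ltrD2r lt_neqAle xx2.
have /andP[k1 k2] := truncn_itv t0.
have kn : (Num.truncn t < n.+1)%N by rewrite -(ltr_nat R) (le_lt_trans k1).
have xE : x = x1 + (x2 - x1) * t / n.+1%:R.
  by rewrite /t; field; apply/andP; split; rewrite gt_eqF.
exists (Ordinal kn); rewrite xE /= !lerD2l !ler_pM2r ?invr_gt0// !ler_pM2l//.
by rewrite k1 ltW.
Qed.

Lemma measure_bigsetU_le (Z : eqType) (A : Z -> set R) (w : R) (zs : seq Z) :
  (forall z, measurable (A z) /\ (lebesgue_measure (A z) <= w%:E)%E) ->
  measurable (\big[setU/set0]_(z <- zs) A z) /\
  (lebesgue_measure (\big[setU/set0]_(z <- zs) A z) <= ((size zs)%:R * w)%:E)%E.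
Proof.
move=> Aw; elim: zs => [|z zs [mU IH]].
  by rewrite big_nil mul0r measure0.
have [mA Az] := Aw z; rewrite big_cons; split; first exact: measurableU.
apply: (@le_trans _ _ (lebesgue_measure (A z) +
    lebesgue_measure (\big[setU/set0]_(z <- zs) A z))%E).
  exact: measureU2.
by rewrite /= -addn1 natrD mulrDl mul1r addrC EFinD leeD.
Qed.

End real_lemmas.

(** * Small covers near perturbed signals *)

Section rectangles.
Context {R : realType} (p u v a b : R).
Hypotheses (p01 : 0 < p < 1) (a0 : 0 <= a) (ab : a < b) (b1 : b <= 1).
Notation mu := (@lebesgue_measure R).
Implicit Types (f g : R -> R) (l c : R).

Local Ltac lra_ab := move: (p01) (a0) (ab) (b1) => *; lra.

(** Minus the change of G when [tilt q] is added to a signal, as [tail_tilt] subtracts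
    [tilt_tail q]. *)
Definition Gtilt (q : {poly R}) l c : R :=
  (1 - p) * tilt_tail q (mmcut v l c) - p * tilt_tail q (mcut u l c).

Definition rect (l1 l2 c1 c2 l c : R) := l1 <= l <= l2 /\ c1 <= c <= c2.

Definition cuts_in (z l c : R) :=
  z <= mcut u l c < b /\ z <= mmcut v l c < b.

(* On a good rectangle the perturbations along q1 and q2 act on the pair
   (G(l,0), G(l,c)) almost like the two coordinate directions. *)
Definition good_rect (l1 l2 c1 c2 : R) :=
  [/\ [/\ 0 < l1, l1 <= l2 & c1 <= c2],
      [/\ -1 < c1, c2 < u, - v < c1 & c2 < 1],
      0 < u /\ 0 < v,
      exists2 z : R, a < z & forall l c, rect l1 l2 c1 c2 l c ->
        cuts_in z l 0 /\ cuts_in z l c &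
      exists q1 q2, [/\ flat_ends a b q1, flat_ends a b q2 &
        forall l c, rect l1 l2 c1 c2 l c ->
        (`|Gtilt q1 l 0 - 1| <= 1 / 4 /\ `|Gtilt q2 l 0| <= 1 / 4) /\
        (`|Gtilt q1 l c| <= 1 / 4 /\ `|Gtilt q2 l c - 1| <= 1 / 4)]].

Definition double_zeros (l1 l2 c1 c2 : R) f : set R :=
  [set c | exists l, [/\ rect l1 l2 c1 c2 l c,
     Gf p u v a b f l 0 = 0 & Gf p u v a b f l c = 0]].

(** A bound on outer measure, so that measurability of the set of bad shocks is not at issue. *)
Definition small_cover (A : set R) (e : R) :=
  exists U, [/\ measurable U, A `<=` U & (mu U <= e%:E)%E].

Lemma supdist_le f g (r : R) : (forall s, Iab a b s -> `|f s - g s| <= r) ->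
  (supdist a b f g <= r%:E)%E.
Proof. by move=> fg; apply: ge_ereal_sup => _ [s sab <-]; rewrite lee_fin fg. Qed.

Lemma supdist_lt f g (r : R) : (supdist a b f g < r%:E)%E ->
  forall s, Iab a b s -> `|f s - g s| <= r.
Proof.
move=> fg s sab; rewrite -lee_fin; apply: le_trans (ltW fg).
by apply: ereal_sup_ubound; exists s.
Qed.

(** Both cutoffs are N/(N+P) with N >= 0 and P >= [nu], so [fraction_lip] applies. In L, the
    constant 3+|l2| absorbs the factors 1+c and 1-c, below 2, the bound on l', and the change of
    P. *)
Lemma cuts_lip (l1 l2 c1 c2 : R) : 0 < l1 -> 0 < u -> 0 < v ->
  -1 < c1 -> c2 < u -> - v < c1 -> c2 < 1 ->
  exists2 L : R, 0 < L & forall l c l' c' : R,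
    l1 <= l <= l2 -> l1 <= l' <= l2 -> c1 <= c <= c2 -> c1 <= c' <= c2 ->
    `|mcut u l c - mcut u l' c'| <= L * (`|l - l'| + `|c - c'|) /\
    `|mmcut v l c - mmcut v l' c'| <= L * (`|l - l'| + `|c - c'|).
Proof.
move=> l10 u0 v0 c1m c2u c1v c21.
pose nu := Num.min (u - c2) (v + c1).
have nu0 : 0 < nu by rewrite lt_min; apply/andP; split; lra.
have nu1 : nu <= u - c2 by rewrite ge_min lexx.
have nu2 : nu <= v + c1 by rewrite ge_min lexx orbT.
pose L := (3 + `|l2|) / nu.
have L0 : 0 < L by rewrite divr_gt0// ltr_wpDr.
exists L => // l c l' c' /andP[h1 h2] /andP[h3 h4] /andP[h5 h6] /andP[h7 h8].
have l'2 : `|l'| <= `|l2| by rewrite !ger0_norm; lra.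
have key (N N' P P' : R) : 0 <= N -> 0 <= P -> 0 < N + P -> nu <= N' + P' ->
    `|N - N'| <= 2 * `|l - l'| + `|l2| * `|c - c'| -> `|P - P'| <= `|c - c'| ->
    `|N / (N + P) - N' / (N' + P')| <= L * (`|l - l'| + `|c - c'|).
  move=> N0 P0 D0 D'0 hN hP; apply: (le_trans (fraction_lip N0 P0 D0 nu0 D'0)).
  rewrite /L mulrAC ler_pM2r ?invr_gt0//.
  have ll : 0 <= `|l - l'| by [].
  have cc : 0 <= `|c - c'| by [].
  have lc : 0 <= `|l2| * `|l - l'| by exact: mulr_ge0.
  rewrite mulrDl !mulrDr; lra.
have mulc (t : R) : 0 < t < 2 -> `|(l - l') * t| <= 2 * `|l - l'|.
  move=> /andP[t0 t2]; rewrite normrM mulrC ler_wpM2r// gtr0_norm//; lra.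
have mull (d : R) : `|d| = `|c - c'| -> `|l' * d| <= `|l2| * `|c - c'|.
  by move=> dE; rewrite normrM dE ler_wpM2r.
split.
  apply: key.
  - by rewrite mulr_ge0//; lra.
  - lra.
  - by rewrite ltr_wpDl ?mulr_ge0//; lra.
  - have : 0 <= l' * (1 + c') by rewrite mulr_ge0//; lra.
    lra.
  - rewrite (_ : l * (1 + c) - l' * (1 + c') = (l - l') * (1 + c) + l' * (c - c')); last by ring.
    by apply: (le_trans (ler_normD _ _)); apply: lerD;
      [apply: mulc; apply/andP; split; lra|exact: mull].
  - by rewrite (_ : u - c - (u - c') = - (c - c')) ?normrN//; ring.
apply: key.
- by rewrite mulr_ge0//; lra.
- lra.
- by rewrite ltr_wpDl ?mulr_ge0//; lra.
- have : 0 <= l' * (1 - c') by rewrite mulr_ge0//; lra.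
  lra.
- rewrite (_ : l * (1 - c) - l' * (1 - c') = (l - l') * (1 - c) + l' * (c' - c)); last by ring.
  apply: (le_trans (ler_normD _ _)); apply: lerD; first by apply: mulc; apply/andP; split; lra.
  by apply: mull; rewrite distrC.
- by rewrite (_ : v + c - (v + c') = c - c')//; ring.
Qed.

Lemma Gf_cuts f (z : R) l c : signal_space a b f -> a < z -> cuts_in z l c ->
  Gf p u v a b f l c =
  (1 - p) * tail b f (mmcut v l c) - p * tail b f (mcut u l c).
Proof.
move=> Xf az [/andP[? ?] /andP[? ?]].
by apply: Gf_tail => //; apply/IabP/andP; split; lra_ab.
Qed.

Lemma average_le (x x' y y' d : R) : `|x - x'| <= d -> `|y - y'| <= d ->
  `|((1 - p) * x - p * y) - ((1 - p) * x' - p * y')| <= d.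
Proof.
move=> hx hy; have /andP[p0 p1] := p01.
rewrite (_ : _ - _ = (1 - p) * (x - x') - p * (y - y')); last by ring.
apply: (le_trans (ler_normB _ _)); rewrite !normrM (gtr0_norm p0) gtr0_norm; last by lra.
have h1 : (1 - p) * `|x - x'| <= (1 - p) * d by rewrite ler_wpM2l//; lra.
have h2 : p * `|y - y'| <= p * d by rewrite ler_wpM2l//; lra.
lra.
Qed.

Lemma Gf_dist f g (r z : R) l c : signal_space a b f -> signal_space a b g ->
  (forall s, Iab a b s -> `|f s - g s| <= r) -> a < z -> 0 < z -> cuts_in z l c ->
  `|Gf p u v a b f l c - Gf p u v a b g l c| <= r / z.
Proof.
move=> Xf Xg fg az z0 zlc; rewrite !(@Gf_cuts _ z)//.
have [h1 h2] := zlc.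
by apply: average_le; apply: (tail_dist a0 ab b1 Xf Xg fg (ltW az) z0).
Qed.

Lemma Gf_lip f (B z d : R) l c l' c' : signal_space a b f ->
  (forall s, Iab a b s -> `|f s| <= B) -> a < z -> 0 < z -> 0 <= B ->
  cuts_in z l c -> cuts_in z l' c' ->
  `|mcut u l c - mcut u l' c'| <= d -> `|mmcut v l c - mmcut v l' c'| <= d ->
  `|Gf p u v a b f l c - Gf p u v a b f l' c'| <= B / z * d.
Proof.
move=> Xf fB az z0 B0 zlc zlc' hm hmm; rewrite !(@Gf_cuts _ z)//.
have [h1 h2] := zlc; have [h3 h4] := zlc'.
have Bz : 0 <= B / z by rewrite divr_ge0// ltW.
apply: average_le.
  apply: (le_trans (tail_lip a0 ab b1 Xf fB (ltW az) z0 h2 h4)).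
  exact: ler_wpM2l.
apply: (le_trans (tail_lip a0 ab b1 Xf fB (ltW az) z0 h1 h3)).
exact: ler_wpM2l.
Qed.

(** * A two-parameter family of perturbed signals *)

Definition comb (x y : R) (q1 q2 : {poly R}) : {poly R} := x%:P * q1 + y%:P * q2.

Lemma comb_deriv x y q1 q2 : (comb x y q1 q2)^`() = comb x y q1^`() q2^`().
Proof. by rewrite /comb derivD !derivM !derivC !mul0r !add0r. Qed.

Lemma comb_eval x y q1 q2 s : (comb x y q1 q2).[s] = x * q1.[s] + y * q2.[s].
Proof. by rewrite /comb !(hornerD, hornerM, hornerC). Qed.

Lemma flat_ends_comb x y q1 q2 : flat_ends a b q1 -> flat_ends a b q2 ->
  flat_ends a b (comb x y q1 q2).
Proof.
move=> [e1 e2 e3 e4] [e5 e6 e7 e8].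
by rewrite /flat_ends !comb_deriv !comb_eval e1 e2 e3 e4 e5 e6 e7 e8 !mulr0 !addr0.
Qed.

Lemma tilt_tail_comb x y q1 q2 s :
  tilt_tail (comb x y q1 q2) s = x * tilt_tail q1 s + y * tilt_tail q2 s.
Proof. by rewrite /tilt_tail !comb_deriv !comb_eval; ring. Qed.

(** The family mixes f with g plus a tilt along x q1 + y q2, where g dominates a multiple of s and
    so leaves room for tilts of either sign. Tails are affine in the signal, which makes G affine in
    (x,y). *)
Lemma perturbation_family f (r : R) q1 q2 : signal_space a b f -> 0 < r ->
  flat_ends a b q1 -> flat_ends a b q2 ->
  exists (h : R -> R -> R -> R) (B k : R), [/\ 0 <= B, 0 < k,
    forall x y : R, 0 <= x <= 1 -> 0 <= y <= 1 ->
      [/\ signal_space a b (h x y), forall s, Iab a b s -> `|h x y s| <= B &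
          (supdist a b f (h x y) < r%:E)%E] &
    forall x y x' y' z l c : R, 0 <= x <= 1 -> 0 <= y <= 1 -> 0 <= x' <= 1 ->
      0 <= y' <= 1 -> a < z -> cuts_in z l c ->
      Gf p u v a b (h x y) l c - Gf p u v a b (h x' y') l c =
      k * ((x' - x) * Gtilt q1 l c + (y' - y) * Gtilt q2 l c)].
Proof.
move=> Xf r0 q1f q2f.
have [g [eta [Xg eta0 geta]]] := positive_signal a0 ab b1 (signal_half a0 ab b1 Xf).
have [M1 M10 q1M] := poly_bounded a0 ab b1 q1^`()^`().
have [M2 M20 q2M] := poly_bounded a0 ab b1 q2^`()^`().
have /(signalP a0)[_ [Bf fB] _ _ _] := Xf.
have /(signalP a0)[_ [Bg gB] _ _ _] := Xg.
have M0 : 0 < M1 + M2 by lra.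
(* The scale [sg] keeps |q''| below eta for all x, y in [0,1], the margin that [signal_tilt] asks
   for. *)
have [sg sg0 sgM] : exists2 sg : R, 0 < sg & eta = sg * (M1 + M2).
  by exists (eta / (M1 + M2)); rewrite ?divr_gt0// divfK// gt_eqF.
pose q (x y : R) := comb (sg * x) (sg * y) q1 q2.
have qq (x y : R) : 0 <= x <= 1 -> 0 <= y <= 1 -> forall s, Iab a b s ->
    `|(q x y)^`()^`().[s]| <= eta.
  move=> /andP[x0 x1] /andP[y0 y1] s sab; rewrite /q !comb_deriv comb_eval.
  apply: (le_trans (ler_normD _ _)); rewrite !normrM (gtr0_norm sg0) (ger0_norm x0) (ger0_norm y0).
  rewrite sgM mulrDr -!mulrA; apply: lerD; rewrite ler_pM2l//.
    by apply: le_trans (q1M _ sab); rewrite ler_piMl.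
  by apply: le_trans (q2M _ sab); rewrite ler_piMl.
pose P (x y s : R) : R := g s + tilt (q x y) s.
have XP (x y : R) : 0 <= x <= 1 -> 0 <= y <= 1 -> signal_space a b (P x y).
  move=> hx hy; apply: signal_tilt => //; first exact: flat_ends_comb.
  move=> s sab; apply: le_trans (geta _ sab); rewrite mulrC ler_wpM2r ?qq//.
  by have /IabP/andP[? _] := sab; lra_ab.
have m0 : Iab a b ((a + b) / 2) by apply/IabP/andP; split; lra_ab.
have Bf0 : 0 <= Bf by apply: le_trans (fB _ m0).
have Bg0 : 0 <= Bg by apply: le_trans (gB _ m0).
pose B := Bf + Bg + eta.
have B0 : 0 < B by rewrite /B; lra.
have PB (x y s : R) : 0 <= x <= 1 -> 0 <= y <= 1 -> Iab a b s -> `|P x y s| <= Bg + eta.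
  move=> hx hy sab; apply: (le_trans (ler_normD _ _)); rewrite lerD ?gB//.
  have /IabP/andP[? ?] := sab; rewrite /tilt normrM; apply: le_trans (qq _ _ hx hy _ sab).
  have s1 : `|s| <= 1 by rewrite gtr0_norm; lra_ab.
  by rewrite ler_piMl.
(* The sup distance from f to the mixture is at most tB, hence at most r/2. *)
pose t := Num.min 1 (r / (2 * B)).
have t0 : 0 < t by rewrite lt_min ltr01 divr_gt0// mulr_gt0.
have t1 : t <= 1 by rewrite ge_min lexx.
have tB : t * B <= r / 2.
  rewrite -ler_pdivlMr//; have -> : r / 2 / B = r / (2 * B) by field; rewrite gt_eqF.
  by rewrite ge_min lexx orbT.
pose h (x y s : R) : R := (1 - t) * f s + t * P x y s.
exists h, B, (t * sg); split; [exact: ltW|exact: mulr_gt0| |].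
  move=> x y hx hy; split.
  - by apply: signal_mix => //; [exact: XP|apply/andP; split; lra].
  - move=> s sab; apply: (le_trans (ler_normD _ _)).
    rewrite !normrM (gtr0_norm t0) ger0_norm; last by lra.
    have := PB _ _ _ hx hy sab; have := fB _ sab => h1 h2.
    have h3 : (1 - t) * `|f s| <= Bf.
      by apply: le_trans h1; rewrite ler_piMl//; lra.
    have h4 : t * `|P x y s| <= Bg + eta.
      by apply: le_trans h2; rewrite ler_piMl//; lra.
    by rewrite /B; lra.
  - apply: (@le_lt_trans _ _ (r / 2)%:E); last by rewrite lte_fin; lra.
    apply: supdist_le => s sab; apply: le_trans tB.
    rewrite (_ : f s - h x y s = t * (f s - P x y s)); last by rewrite /h; ring.
    rewrite normrM (gtr0_norm t0) ler_pM2l//; apply: (le_trans (ler_normB _ _)).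
    by have := PB _ _ _ hx hy sab; have := fB _ sab; rewrite /B; lra.
move=> x y x' y' z l c hx hy hx' hy' az zlc.
have hab (w w' : R) : 0 <= w <= 1 -> 0 <= w' <= 1 -> signal_space a b (h w w').
  by move=> hw hw'; apply: signal_mix => //; [exact: XP|apply/andP; split; lra].
rewrite !(@Gf_cuts _ z)//; [|exact: hab..].
have tE (w w' s : R) : 0 <= w <= 1 -> 0 <= w' <= 1 -> z <= s < b ->
    tail b (h w w') s = (1 - t) * tail b f s +
      t * (tail b g s - sg * (w * tilt_tail q1 s + w' * tilt_tail q2 s)).
  move=> hw hw' /andP[zs sb].
  rewrite /h (tail_mix a0 ab b1 _ Xf (XP _ _ hw hw')); last by lra.
  rewrite /P (tail_tilt a0 ab b1 Xg (flat_ends_comb _ _ q1f q2f)); last first.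
    by apply/andP; split; lra.
  by rewrite tilt_tail_comb; ring.
have [hm hmm] := zlc.
by rewrite !tE// /Gtilt; ring.
Qed.

(** The order of the constants is essential: E, F and D depend on f, r and the rectangle but not on
    the grid, so n can be chosen last, in terms of D and e. *)
Lemma perturb_small_cover l1 l2 c1 c2 f (r e : R) : good_rect l1 l2 c1 c2 ->
  signal_space a b f -> 0 < r -> 0 < e ->
  exists g, [/\ signal_space a b g, (supdist a b f g < r%:E)%E &
    exists2 d : R, 0 < d & forall g', signal_space a b g' ->
      (supdist a b g g' < d%:E)%E -> small_cover (double_zeros l1 l2 c1 c2 g') e].
Proof.
move=> [[l10 l12 c12] [c1m c2u c1v c21] [u0 v0] [z az zcut] [q1 [q2 [q1f q2f qQ]]]].
move=> Xf r0 e0; have z0 : 0 < z by lra_ab.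
have [h [B [k [B0 k0 hX hG]]]] := perturbation_family Xf r0 q1f q2f.
(* The shock range is enlarged to contain 0, because G is also compared at shock 0. *)
have [L L0 cutL] : exists2 L : R, 0 < L & forall l c l' c' : R,
    l1 <= l <= l2 -> l1 <= l' <= l2 ->
    Num.min c1 0 <= c <= Num.max c2 0 -> Num.min c1 0 <= c' <= Num.max c2 0 ->
    `|mcut u l c - mcut u l' c'| <= L * (`|l - l'| + `|c - c'|) /\
    `|mmcut v l c - mmcut v l' c'| <= L * (`|l - l'| + `|c - c'|).
  by apply: cuts_lip => //; rewrite ?lt_min ?gt_max; apply/andP; split=> //; lra.
have c0in : Num.min c1 0 <= 0 <= Num.max c2 0 by rewrite ge_min le_max lexx !orbT.
have cin (c : R) : c1 <= c <= c2 -> Num.min c1 0 <= c <= Num.max c2 0.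
  by move=> /andP[h1 h2]; rewrite ge_min le_max h1 h2.
pose w : R := (l2 - l1) + (c2 - c1).
have w0 : 0 <= w by rewrite /w; lra.
(* Error budget in units of 1/(n+1): 1 for replacing a nearby signal by the perturbed one, the rest
   for moving from the zero to the corner of its cell. *)
pose E : R := 1 + B / z * (L * w).
have Bz0 : 0 <= B / z by rewrite divr_ge0// ltW.
have E0 : 0 < E by rewrite ltr_wpDr// mulr_ge0// mulr_ge0// ltW.
(* Values of G for two perturbations bad at one corner differ by at most 2E/(n+1), and this
   difference is k/(n+1) times a combination of index differences; the factor n+1 drops out. *)
pose F : R := 2 * E / k.
have F0 : 0 <= F by rewrite divr_ge0//; lra.
pose D := (Num.truncn (2 * F)).+1.
have FD : 2 * F <= D%:R by apply: ltW; exact: Num.Theory.truncnS_gt.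
(* With this n, (D+1)^2 intervals of length (c2-c1)/(n+1) have total length at most e. *)
pose n := (Num.truncn ((D.+1 * D.+1)%:R * (c2 - c1) / e)).
have ne : (D.+1 * D.+1)%:R * (c2 - c1) / n.+1%:R <= e.
  rewrite ler_pdivrMr// [leRHS]mulrC -ler_pdivrMr//; apply: ltW; exact: Num.Theory.truncnS_gt.
have N0 : (0 : R) < n.+1%:R by [].
pose pt (x1 x2 : R) (i : 'I_n.+1) : R := x1 + (x2 - x1) * i%:R / n.+1%:R.
pose par (i : 'I_n.+1) : R := i%:R / n.+1%:R.
have par01 i : 0 <= par i <= 1.
  by rewrite divr_ge0//= ler_pdivrMr// mul1r ler_nat ltnW.
have ptin (x1 x2 : R) i : x1 <= x2 -> x1 <= pt x1 x2 i <= x2.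
  move=> x12; have /andP[i0 i1] := par01 i; rewrite /pt -mulrA -/(par i).
  have : 0 <= (x2 - x1) * par i by rewrite mulr_ge0//; lra.
  have : (x2 - x1) * par i <= x2 - x1 by rewrite ler_piMr//; lra.
  by move=> ? ?; apply/andP; split; lra.
pose hh (ij : 'I_n.+1 * 'I_n.+1) := h (par ij.1) (par ij.2).
pose bad (zz ij : 'I_n.+1 * 'I_n.+1) :=
  (`|Gf p u v a b (hh ij) (pt l1 l2 zz.1) 0| <= E / n.+1%:R) &&
  (`|Gf p u v a b (hh ij) (pt l1 l2 zz.1) (pt c1 c2 zz.2)| <= E / n.+1%:R).
have prect zz : rect l1 l2 c1 c2 (pt l1 l2 zz.1) (pt c1 c2 zz.2) by split; exact: ptin.
have close zz ij ij' : bad zz ij -> bad zz ij' ->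
    (ij.1 <= ij'.1 + D)%N /\ (ij.2 <= ij'.2 + D)%N.
  move=> /andP[b0 bc] /andP[b0' bc'].
  have [cut0 cutc] := zcut _ _ (prect zz).
  have [[g11 g12] [g21 g22]] := qQ _ _ (prect zz).
  have key (c : R) : cuts_in z (pt l1 l2 zz.1) c ->
      `|Gf p u v a b (hh ij) (pt l1 l2 zz.1) c| <= E / n.+1%:R ->
      `|Gf p u v a b (hh ij') (pt l1 l2 zz.1) c| <= E / n.+1%:R ->
      `|(ij'.1%:R - ij.1%:R) * Gtilt q1 (pt l1 l2 zz.1) c +
        (ij'.2%:R - ij.2%:R) * Gtilt q2 (pt l1 l2 zz.1) c| <= F.
    move=> cutz k1 k2.
    have := hG _ _ _ _ _ _ _ (par01 ij.1) (par01 ij.2) (par01 ij'.1) (par01 ij'.2) az cutz.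
    rewrite -/(hh ij) -/(hh ij') => GE.
    have -> : (ij'.1%:R - ij.1%:R) * Gtilt q1 (pt l1 l2 zz.1) c +
        (ij'.2%:R - ij.2%:R) * Gtilt q2 (pt l1 l2 zz.1) c = n.+1%:R / k *
        (Gf p u v a b (hh ij) (pt l1 l2 zz.1) c - Gf p u v a b (hh ij') (pt l1 l2 zz.1) c).
      by rewrite GE /par; field; apply/andP; split; rewrite gt_eqF.
    rewrite normrM gtr0_norm ?divr_gt0//.
    have -> : F = n.+1%:R / k * (E / n.+1%:R + E / n.+1%:R).
      by rewrite /F; field; apply/andP; split; rewrite gt_eqF.
    rewrite ler_pM2l ?divr_gt0//; apply: (le_trans (ler_normB _ _)).
    exact: lerD.
  have [h1 h2] := near_identity_inverse g11 g12 g21 g22 (key _ cut0 b0 b0') (key _ cutc bc bc').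
  have nd (i j : 'I_n.+1) : `|(j%:R : R) - i%:R| <= 2 * F -> (i <= j + D)%N.
    move=> ij1; have := le_trans ij1 FD; rewrite distrC => /(le_trans (ler_norm _)).
    by rewrite lerBlDl -natrD ler_nat.
  by split; exact: nd.
have [ij badij] : exists p, (#|[pred z | bad z p]| <= D.+1 * D.+1)%N.
  by apply: pigeonhole_close close; rewrite card_prod card_ord.
have [Xh hB hr] := hX _ _ (par01 ij.1) (par01 ij.2).
exists (hh ij); split => //.
(* By [Gf_dist], signals this close differ in G by at most 1/(n+1), the first unit of E. *)
exists (z / n.+1%:R); first by rewrite divr_gt0.
move=> g Xg /supdist_lt hg.
(* The cover needs only the shock coordinate; pairs sharing it give the same interval, counted with
   repetition. *)
pose cell (zz : 'I_n.+1 * 'I_n.+1) : set R :=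
  `[c1 + (c2 - c1) * zz.2%:R / n.+1%:R, c1 + (c2 - c1) * zz.2.+1%:R / n.+1%:R]%classic.
have cellm zz : measurable (cell zz) /\ (mu (cell zz) <= ((c2 - c1) / n.+1%:R)%:E)%E.
  split; first exact: measurable_itv.
  have /= -> := lebesgue_measure_itv `[c1 + (c2 - c1) * zz.2%:R / n.+1%:R,
     c1 + (c2 - c1) * zz.2.+1%:R / n.+1%:R].
  have c0 : 0 <= (c2 - c1) / n.+1%:R by rewrite divr_ge0//; lra.
  case: ifP => _; rewrite -?EFinB lee_fin//.
  rewrite -[zz.2.+1%:R]natr1 mulrDr mulr1 mulrDl.
  by rewrite [leLHS](_ : _ = (c2 - c1) / n.+1%:R)//; ring.
have [mU Ue] := measure_bigsetU_le (enum [pred z | bad z ij]) cellm.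
exists (\big[setU/set0]_(z <- enum [pred z | bad z ij]) cell z); split => //; last first.
  apply: le_trans Ue _; rewrite -cardE lee_fin; apply: le_trans ne.
  rewrite mulrA ler_pM2r ?invr_gt0//; apply: ler_wpM2r; first by lra.
  by rewrite ler_nat.
move=> c [l [[/[dup] ll /andP[ll1 ll2] /[dup] cc /andP[cc1 cc2]] G0 Gc]].
have [i /andP[i1 i2]] := grid_cell n ll.
have [j /andP[j1 j2]] := grid_cell n cc.
have badz : bad (i, j) ij.
  have [cut0 cutc] := zcut _ _ (prect (i, j)).
  have [cut0' cutc'] := zcut l c (conj ll cc).
  have step (x1 x2 x : R) (m : 'I_n.+1) : x1 + (x2 - x1) * m%:R / n.+1%:R <= x ->
      x <= x1 + (x2 - x1) * m.+1%:R / n.+1%:R -> `|x - pt x1 x2 m| <= (x2 - x1) / n.+1%:R.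
    rewrite /pt -[m.+1%:R]natr1 mulrDr mulr1 mulrDl.
    set A := _ * _ / _; set T := _ / _ => y1 y2.
    by rewrite ler_norml; apply/andP; split; lra.
  have dl := step _ _ _ _ i1 i2; have dc := step _ _ _ _ j1 j2.
  have dw : `|l - pt l1 l2 i| + `|c - pt c1 c2 j| <= w / n.+1%:R.
    by rewrite /w mulrDl lerD.
  have EN : E / n.+1%:R = z / n.+1%:R / z + B / z * (L * (w / n.+1%:R)).
    by rewrite /E; field; apply/andP; split; rewrite gt_eqF.
  have fin (c' c0 : R) : cuts_in z l c0 -> cuts_in z (pt l1 l2 i) c' ->
     `|mcut u l c0 - mcut u (pt l1 l2 i) c'| <= L * (w / n.+1%:R) ->
     `|mmcut v l c0 - mmcut v (pt l1 l2 i) c'| <= L * (w / n.+1%:R) ->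
     Gf p u v a b g l c0 = 0 ->
     `|Gf p u v a b (hh ij) (pt l1 l2 i) c'| <= E / n.+1%:R.
    move=> k1 k2 d1 d2 G00.
    have e1 := Gf_dist Xh Xg hg az z0 k1.
    have e2 := Gf_lip Xh hB az z0 B0 k1 k2 d1 d2.
    rewrite G00 subr0 in e1; rewrite EN.
    rewrite (_ : Gf _ _ _ _ _ _ _ c' = Gf p u v a b (h (par ij.1) (par ij.2)) l c0 -
      (Gf p u v a b (h (par ij.1) (par ij.2)) l c0 -
       Gf p u v a b (h (par ij.1) (par ij.2)) (pt l1 l2 i) c')); last by rewrite /hh; ring.
    by apply: (le_trans (ler_normB _ _)); apply: lerD.
  have Lw (x : R) : x <= w / n.+1%:R -> L * x <= L * (w / n.+1%:R) by move=> ?; rewrite ler_pM2l.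
  apply/andP; split => /=.
    have dw0 : `|l - pt l1 l2 i| + `|0 - 0 : R| <= w / n.+1%:R.
      by rewrite subrr normr0 addr0; apply: le_trans dw; rewrite lerDl.
    have [m1 m2] := cutL l 0 (pt l1 l2 i) 0 ll (ptin _ _ _ l12) c0in c0in.
    by apply: (fin 0 0) => //; [apply: le_trans m1 _|apply: le_trans m2 _]; exact: Lw.
  have [m1 m2] := cutL l c (pt l1 l2 i) (pt c1 c2 j) ll (ptin _ _ _ l12)
    (cin _ cc) (cin _ (ptin _ _ _ c12)).
  by apply: (fin _ c) => //; [apply: le_trans m1 _|apply: le_trans m2 _]; exact: Lw.
have -> : (\big[setU/set0]_(z <- enum [pred z | bad z ij]) cell z) =
    \bigcup_(z in [set` enum [pred z | bad z ij]]) cell z by rewrite bigcup_seq.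
exists (i, j); first by rewrite /= mem_enum.
by rewrite /cell /= in_itv /= j1 j2.
Qed.

End rectangles.

(** * Good rectangles around regular pairs *)

Section good_rectangles.
Context {R : realType} (p u v a b : R).
Hypotheses (p01 : 0 < p < 1) (a0 : 0 <= a) (ab : a < b) (b1 : b <= 1).
Hypotheses (u0 : 0 < u) (v0 : 0 < v) (uv : u != v).
Notation mu := (@lebesgue_measure R).
Implicit Types (f g : R -> R) (l c : R).

Local Ltac lra_ab := move: (p01) (a0) (ab) (b1) (u0) (v0) => *; lra.

Section cvg_cuts.
Context {T : Type} (F : set_system T) {FF : Filter F}.
Implicit Types (x y : T -> R).

Lemma cvg_mcut x y l c : x @ F --> l -> y @ F --> c ->
  l * (1 + c) + (u - c) != 0 -> mcut u (x t) (y t) @[t --> F] --> mcut u l c.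
Proof.
move=> xl yc D0; have xy : x t * (1 + y t) @[t --> F] --> l * (1 + c).
  by apply: cvgM => //; apply: cvgD => //; exact: cvg_cst.
apply: cvgM => //; apply: cvgV => //; apply: cvgD => //.
by apply: cvgB => //; exact: cvg_cst.
Qed.

Lemma cvg_mmcut x y l c : x @ F --> l -> y @ F --> c ->
  l * (1 - c) + (v + c) != 0 -> mmcut v (x t) (y t) @[t --> F] --> mmcut v l c.
Proof.
move=> xl yc D0; have xy : x t * (1 - y t) @[t --> F] --> l * (1 - c).
  by apply: cvgM => //; apply: cvgB => //; exact: cvg_cst.
apply: cvgM => //; apply: cvgV => //; apply: cvgD => //.
by apply: cvgD => //; exact: cvg_cst.
Qed.

Lemma cvg_horner (q : {poly R}) x l : x @ F --> l -> q.[x t] @[t --> F] --> q.[l].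
Proof. by move=> xl; apply: (cvg_comp _ _ xl); exact: continuous_horner. Qed.

Lemma cvg_tilt_tail q x l : x @ F --> l ->
  tilt_tail q (x t) @[t --> F] --> tilt_tail q l.
Proof.
move=> xl; apply: cvgD.
  apply: cvgM; first exact: cvg_horner.
  by apply: cvgB; [exact: cvg_cst|apply: cvgM => //; exact: cvg_cst].
by apply: cvgM; [exact: cvg_cst|exact: cvg_horner].
Qed.

End cvg_cuts.

Lemma fraction_eq (N P N' P' : R) : N + P != 0 -> N' + P' != 0 ->
  N / (N + P) = N' / (N' + P') -> N * P' = N' * P.
Proof.
move=> D0 D0' /eqP; rewrite eqr_div// => /eqP.
by rewrite !mulrDr (mulrC N N') => /addrI.
Qed.

(** Rational corners make the family of rectangles countable while still fitting inside any
    neighbourhood. *)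
Lemma nbhs_rat_rect l c (Q : R * R -> Prop) : (\forall t \near (l, c), Q t) ->
  exists s1 s2 r1 r2 : rat, [/\ ratr s1 < l /\ l < ratr s2,
    ratr r1 < c /\ c < ratr r2 &
    forall x y, rect (ratr s1) (ratr s2) (ratr r1) (ratr r2) x y -> Q (x, y)].
Proof.
move=> /nbhs_ballP[e /= e0 eQ].
have around x : exists s1 s2 : rat, [/\ x - e < ratr s1, ratr s1 < x, x < ratr s2 &
    ratr s2 < x + e].
  have [s1] := @rat_in_itvoo _ (x - e) x ltac:(by rewrite ltrBlDr ltrDl).
  rewrite in_itv/= => /andP[? ?].
  have [s2] := @rat_in_itvoo _ x (x + e) ltac:(by rewrite ltrDl).
  by rewrite in_itv/= => /andP[? ?]; exists s1, s2.
have [s1 [s2 [s1e s1l ls2 s2e]]] := around l.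
have [r1 [r2 [r1e r1c cr2 r2e]]] := around c.
exists s1, s2, r1, r2; split => // x y [/andP[sx xs] /andP[ry yr]].
by apply: eQ; split; rewrite /ball /= distrC ltr_distl;
  apply/andP; split; [exact: lt_le_trans s1e sx|exact: le_lt_trans xs s2e|
                      exact: lt_le_trans r1e ry|exact: le_lt_trans yr r2e].
Qed.

(* The listed shocks are those at which, for every l, a cutoff for c meets the
   other type's cutoff for 0 or for c; c = 0 is where same-type cutoffs meet. *)
Lemma good_rect_at l c : 0 < l -> -1 < c -> c < u -> - v < c -> c < 1 -> c != 0 ->
  Iab a b (mcut u l 0) -> Iab a b (mmcut v l 0) ->
  Iab a b (mcut u l c) -> Iab a b (mmcut v l c) ->
  c \notin [:: (u - v) / (1 + u); (u - v) / (1 + v); (u - v) / (2 + u + v)] ->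
  exists q1 q2 r1 r2 : rat,
    good_rect p u v a b (ratr q1) (ratr q2) (ratr r1) (ratr r2) /\
    rect (ratr q1) (ratr q2) (ratr r1) (ratr r2) l c.
Proof.
move=> l0 c1m cu cv c1 c0 /IabP/andP[ma mb] /IabP/andP[mma mmb].
move=> /IabP/andP[mca mcb] /IabP/andP[mmca mmcb] cnot.
have ln0 : l != 0 by rewrite gt_eqF.
have D1 : l * (1 + 0) + (u - 0) != 0 by rewrite gt_eqF//; lra_ab.
have D2 : l * (1 - 0) + (v + 0) != 0 by rewrite gt_eqF//; lra_ab.
have D3 : l * (1 + c) + (u - c) != 0.
  by rewrite gt_eqF// addr_gt0 ?mulr_gt0//; lra_ab.
have D4 : l * (1 - c) + (v + c) != 0.
  by rewrite gt_eqF// addr_gt0 ?mulr_gt0//; lra_ab.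
have cancel (x y : R) : l * x = l * y -> x = y by move/(mulfI ln0).
(* After cross-multiplying and cancelling l, each coincidence of cutoffs forces u = v, c = 0 or one
   of the listed shocks. *)
have n12 : mcut u l 0 != mmcut v l 0.
  apply/eqP => /(fraction_eq D1 D2) H; move/eqP: uv; apply.
  by apply: cancel; move: H; lra.
have n13 : mcut u l 0 != mcut u l c.
  apply/eqP => /(fraction_eq D1 D3) H; move/eqP: c0; apply.
  have /eqP : c * (1 + u) = 0 by apply: cancel; move: H; lra.
  by rewrite mulf_eq0 => /orP[/eqP//|/eqP]; lra_ab.
have n14 : mcut u l 0 != mmcut v l c.
  apply/eqP => /(fraction_eq D1 D4) H; move: cnot; rewrite !inE.
  have E : c * (1 + u) = u - v by apply: cancel; move: H; lra.
  by rewrite -E mulfK ?eqxx// gt_eqF//; lra_ab.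
have n23 : mmcut v l 0 != mcut u l c.
  apply/eqP => /(fraction_eq D2 D3) H; move: cnot; rewrite !inE.
  have E : c * (1 + v) = u - v by apply: cancel; move: H; lra.
  by rewrite -{2}E mulfK ?eqxx ?orbT// gt_eqF//; lra_ab.
have n34 : mcut u l c != mmcut v l c.
  apply/eqP => /(fraction_eq D3 D4) H; move: cnot; rewrite !inE.
  have E : c * (2 + u + v) = u - v by apply: cancel; move: H; lra.
  by rewrite -{3}E mulfK ?eqxx ?orbT// gt_eqF//; lra_ab.
(* Where q' = 0, [tilt_tail q] is 2q, and [Gtilt] weights its value at [mcut] by -p; a value k of q
   there contributes exactly 1. *)
pose k := - (1 / (2 * p)).
have pk : p * (2 * k) = -1 by rewrite /k; field; rewrite gt_eqF//; lra_ab.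
(* Here q1 sees only [mcut] at shock 0, and q2 below only [mcut] at shock c; double zeros at the
   other cutoffs make the matrix at (l,c) the identity. *)
have [|q1 [q1x q1'x q1z]] := @hermite_interpolation _
  [:: a; b; mmcut v l 0; mcut u l c; mmcut v l c] (mcut u l 0) k.
  by rewrite !inE !negb_or n12 n13 n14 (gt_eqF ma) (lt_eqF mb).
have [|q2 [q2x q2'x q2z]] := @hermite_interpolation _
  [:: a; b; mcut u l 0; mmcut v l 0; mmcut v l c] (mcut u l c) k.
  by rewrite !inE !negb_or (eq_sym _ (mcut u l 0)) n13
    (eq_sym _ (mmcut v l 0)) n23 n34 (gt_eqF mca) (lt_eqF mcb).
have tz (q : {poly R}) x : q.[x] = 0 /\ q^`().[x] = 0 -> tilt_tail q x = 0.
  by move=> [e1 e2]; rewrite /tilt_tail e1 e2; ring.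
have G10 : Gtilt p u v q1 l 0 = 1.
  rewrite /Gtilt (tz q1); last by apply: q1z; rewrite !inE eqxx !orbT.
  by rewrite /tilt_tail q1x q1'x; lra.
have G1c : Gtilt p u v q1 l c = 0.
  rewrite /Gtilt !(tz q1); [by ring| |]; by apply: q1z; rewrite !inE eqxx !orbT.
have G20 : Gtilt p u v q2 l 0 = 0.
  rewrite /Gtilt !(tz q2); [by ring| |]; by apply: q2z; rewrite !inE eqxx !orbT.
have G2c : Gtilt p u v q2 l c = 1.
  rewrite /Gtilt (tz q2); last by apply: q2z; rewrite !inE eqxx !orbT.
  by rewrite /tilt_tail q2x q2'x; lra.
have q1f : flat_ends a b q1.
  have [e1 e2] : q1.[a] = 0 /\ q1^`().[a] = 0 by apply: q1z; rewrite !inE eqxx.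
  have [e3 e4] : q1.[b] = 0 /\ q1^`().[b] = 0 by apply: q1z; rewrite !inE eqxx orbT.
  by [].
have q2f : flat_ends a b q2.
  have [e1 e2] : q2.[a] = 0 /\ q2^`().[a] = 0 by apply: q2z; rewrite !inE eqxx.
  have [e3 e4] : q2.[b] = 0 /\ q2^`().[b] = 0 by apply: q2z; rewrite !inE eqxx orbT.
  by [].
pose m := Num.min (Num.min (mcut u l 0) (mmcut v l 0)) (Num.min (mcut u l c) (mmcut v l c)).
have am : a < m by rewrite !lt_min ma mma mca mmca.
(* Half way to the least cutoff, so that z lies strictly below all four at (l,c) and remains below
   them nearby. *)
pose z := (a + m) / 2.
have az : a < z by rewrite /z; lra.
have zm : z < m by rewrite /z; lra.
have [z1 z2 z3 z4] : [/\ z < mcut u l 0, z < mmcut v l 0, z < mcut u l c & z < mmcut v l c].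
  by move: zm; rewrite !lt_min => /andP[/andP[-> ->] /andP[-> ->]].
pose F : set_system (R * R) := nbhs ((l, c) : R * R).
have FF : Filter F by exact: nbhs_filter.
have Fx : (fun t : R * R => t.1) @ F --> l by exact: cvg_fst.
have Fy : (fun t : R * R => t.2) @ F --> c by exact: cvg_snd.
have F0 : (fun _ : R * R => 0 : R) @ F --> (0 : R) by exact: cvg_cst.
have Fm0 := @cvg_mcut _ _ FF _ _ _ _ Fx F0 D1.
have Fmm0 := @cvg_mmcut _ _ FF _ _ _ _ Fx F0 D2.
have Fmc := @cvg_mcut _ _ FF _ _ _ _ Fx Fy D3.
have Fmmc := @cvg_mmcut _ _ FF _ _ _ _ Fx Fy D4.
have FG (q : {poly R}) (x y : R * R -> R) x0 y0 : x @ F --> x0 -> y @ F --> y0 ->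
    (1 - p) * tilt_tail q (y t) - p * tilt_tail q (x t) @[t --> F] -->
    (1 - p) * tilt_tail q y0 - p * tilt_tail q x0.
  by move=> hx hy; apply: cvgB; (apply: cvgM; [exact: cvg_cst|exact: cvg_tilt_tail]).
pose Q (t : R * R) := [/\ [/\ 0 < t.1, -1 < t.2, t.2 < u, - v < t.2 & t.2 < 1],
  cuts_in u v b z t.1 0 /\ cuts_in u v b z t.1 t.2 &
  (`|Gtilt p u v q1 t.1 0 - 1| <= 1 / 4 /\ `|Gtilt p u v q2 t.1 0| <= 1 / 4) /\
  (`|Gtilt p u v q1 t.1 t.2| <= 1 / 4 /\ `|Gtilt p u v q2 t.1 t.2 - 1| <= 1 / 4)].
have e4 : (0 : R) < 1 / 4 by lra.
have dist1 (f : R * R -> R) y : f @ F --> y -> \forall t \near F, `|f t - y| <= 1 / 4.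
  by move=> fy; exact: (cvgr_distC_le _ _ fy).
have dist0 (f : R * R -> R) : f @ F --> (0 : R) -> \forall t \near F, `|f t| <= 1 / 4.
  by move=> /dist1; apply: filterS => t; rewrite subr0.
have nearQ : \forall t \near F, Q t.
  near=> t; split.
  - split; near: t.
    + exact: (cvgr_gt _ Fx _ l0).
    + exact: (cvgr_gt _ Fy _ c1m).
    + exact: (cvgr_lt _ Fy _ cu).
    + exact: (cvgr_gt _ Fy _ cv).
    + exact: (cvgr_lt _ Fy _ c1).
  - split; (split; apply/andP; split); near: t.
    + exact: (cvgr_ge _ Fm0 _ z1).
    + exact: (cvgr_lt _ Fm0 _ mb).
    + exact: (cvgr_ge _ Fmm0 _ z2).
    + exact: (cvgr_lt _ Fmm0 _ mmb).
    + exact: (cvgr_ge _ Fmc _ z3).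
    + exact: (cvgr_lt _ Fmc _ mcb).
    + exact: (cvgr_ge _ Fmmc _ z4).
    + exact: (cvgr_lt _ Fmmc _ mmcb).
  - split; split; near: t.
    + have := FG q1 _ _ _ _ Fm0 Fmm0; rewrite -/(Gtilt p u v q1 l 0) G10.
      exact: dist1.
    + have := FG q2 _ _ _ _ Fm0 Fmm0; rewrite -/(Gtilt p u v q2 l 0) G20.
      exact: dist0.
    + have := FG q1 _ _ _ _ Fmc Fmmc; rewrite -/(Gtilt p u v q1 l c) G1c.
      exact: dist0.
    + have := FG q2 _ _ _ _ Fmc Fmmc; rewrite -/(Gtilt p u v q2 l c) G2c.
      exact: dist1.
have [s1 [s2 [r1 [r2 [[s1l ls2] [r1c cr2] Qr]]]]] := nbhs_rat_rect nearQ.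
exists s1, s2, r1, r2.
have s12 := ltW (lt_trans s1l ls2); have r12 := ltW (lt_trans r1c cr2).
(* The strict bounds on the corners come from Q itself, since the closed rectangle contains them. *)
have [[? ? _ ? _] _ _] : Q (ratr s1, ratr r1) by apply: Qr; split; rewrite lexx.
have [[_ _ ? _ ?] _ _] : Q (ratr s2, ratr r2).
  by apply: Qr; split; rewrite lexx andbT.
split; last by split; rewrite !ltW.
split => //.
- by exists z => // x y /Qr[].
- by exists q1, q2; split=> // x y /Qr[].
Unshelve. all: by end_near. Qed.

(** The intersection of the covers is one measurable set containing [A], of measure at most 1/(k+1)
    for every k. *)
Lemma negligible_small_cover (A : set R) :
  (forall k, small_cover A k.+1%:R^-1) -> mu.-negligible A.
Proof.
move=> /choice[U Ucov]; have mI : measurable (\bigcap_k U k).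
  by apply: bigcapT_measurable => k; have [] := Ucov k.
exists (\bigcap_k U k); split => //; last first.
  by move=> x Ax k _; have [_ + _] := Ucov k; exact.
apply/eqP; rewrite eq_le measure_ge0 andbT; apply/lee_addgt0Pr => e e0; rewrite add0e.
pose k := Num.truncn e^-1.
have [mU _ Uk] := Ucov k.
apply: (@le_trans _ _ (mu (U k))).
  by apply: le_measure; rewrite ?inE//; exact: bigcap_inf.
apply: (le_trans Uk); rewrite lee_fin -[leRHS]invrK lef_pV2 ?posrE ?invr_gt0//.
by apply: ltW; exact: Num.Theory.truncnS_gt.
Qed.

End good_rectangles.

(** * Assembly over countably many rational rectangles *)

Theorem theorem5 (R : realType) (p u v a b eps0 : R) :
  0 < p < 1 -> 0 < u -> 0 < v -> u != v ->
  0 <= a -> a < b -> b <= 1 ->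
  Eset u v a b 0 !=set0 -> 0 < eps0 ->
  exists N : set (R -> R),
    first_category_in a b (signal_space a b) N /\
    forall f, signal_space a b f -> ~ N f ->
      (@lebesgue_measure R).-negligible (Sf p u v a b eps0 f).
Proof.
move=> p01 u0 v0 uv a0 ab b1 _ _.
pose good (q : rat * rat * rat * rat) := let: (l1, l2, c1, c2) := q in
  good_rect p u v a b (ratr l1) (ratr l2) (ratr c1) (ratr c2).
pose zeros (q : rat * rat * rat * rat) := let: (l1, l2, c1, c2) := q in
  double_zeros p u v a b (ratr l1) (ratr l2) (ratr c1) (ratr c2).
(* The index n codes a rational rectangle and a level k; invalid codes and rectangles that are not
   good give the empty set. *)
pose A n : set (R -> R) :=
  if unpickle n is Some (q, k) then
    [set f | [/\ signal_space a b f, good q & ~ small_cover (zeros q f) k.+1%:R^-1]]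
  else set0.
exists (\bigcup_n A n); split.
  split.
    by move=> f [n _]; rewrite /A; case: unpickle => [[q k] []|].
  exists A; split => // n; rewrite /nowhere_dense_in; apply/seteqP; split => // f.
  move=> [Xf [r [r0 clA]]].
  have ff : (supdist a b f f < r%:E)%E.
    apply: (@le_lt_trans _ _ 0%:E); last by rewrite lte_fin.
    by apply: supdist_le => s _; rewrite subrr normr0.
  (* That f is in the closure serves to show that the rectangle is good. A perturbed g in the ball
     then has a neighbourhood free of [A n], although g is in the closure too. *)
  have [_ /(_ r r0)[h [Xh [Ah _]]]] := clA f Xf ff.
  move: clA Ah; rewrite /A; case: unpickle => [[[[[l1 l2] c1] c2] k]|//] clA [_ gq _].
  have [|g [Xg fg [d d0 near_g]]] := perturb_small_cover p01 a0 ab b1 gq Xf r0 (e := k.+1%:R^-1).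
    by rewrite invr_gt0.
  have [_ /(_ d d0)[g' [Xg' [[_ _ ncov] gg']]]] := clA g Xg fg.
  by apply: ncov; exact: near_g.
move=> f Xf Nf.
have cov q k : good q -> small_cover (zeros q f) k.+1%:R^-1.
  move=> gq; apply: contrapT => ncov; apply: Nf; exists (pickle (q, k)); first exact: I.
  by rewrite /A pickleK.
pose B n : set R :=
  if unpickle n is Some q then [set c | good q /\ zeros q f c] else set0.
pose cs : seq R := [:: (u - v) / (1 + u); (u - v) / (1 + v); (u - v) / (2 + u + v)].
(* Apart from three shocks, each c in S_f has, with its l, a good rational rectangle around it,
   leaving countably many sets of double zeros. *)
have sub : Sf p u v a b eps0 f `<=` [set c | c \in cs] `|` \bigcup_n B n.
  move=> c [[[/andP[c1m cu] [/andP[vc c1] [_ c0]]] _] [l [[l0 [i1 i2]] [[_ [i3 i4]] [G0 Gc]]]]].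
  have [ccs|ccs] := boolP (c \in cs); [by left|right].
  have [l1 [l2 [r1 [r2 [gr rc]]]]] := good_rect_at p01 a0 ab b1 u0 v0 uv l0
    c1m cu vc c1 c0 i1 i2 i3 i4 ccs.
  exists (pickle (l1, l2, r1, r2)); first exact: I.
  rewrite /B pickleK; split => //=.
  by exists l.
apply: (@negligibleS _ _ R (@lebesgue_measure R) _ _ sub).
apply: negligibleU.
  have ccs : countable [set c | c \in cs].
    by apply: finite_set_countable; exact: finite_seq.
  apply/negligibleP; last exact: countable_lebesgue_measure0.
  by apply: countable_measurable ccs => t; exact: measurable_set1.
apply: negligible_bigcup => n; rewrite /B; case: unpickle => [q|]; last first.
  exact: negligible_set0.
have [gq|ngq] := pselect (good q).
  by apply: negligibleS (negligible_small_cover (fun k => cov q k gq)) => c [].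
by apply: negligibleS (negligible_set0 _) => c [].
Qed.
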